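(* Let $S\subseteq\mathbb R^n$ be a nonempty closed convex set, let $\bar w$, $N$, $Y$, $r$, $F\in\mathbb R^{n\times k}$ and $B=N^\top F$ (with $k\ge r$ and $\operatorname{rank}(B)=r$) be as in the context, and let $\phi:\mathbb R^n\to\mathbb R\cup\{+\infty\}$ be an admissible Legendre regularizer for $S$, with reduced function $\psi(y)=\phi(\bar w+Ny)$ that is $\mu$-strongly convex, $\mu>0$. Then the following hold: 1. For every $z\in\mathbb R^k$, the optimization problem $\min_{w\in\mathbb R^n}\{\langle Fz,w\rangle+\phi(w)\}$ has a unique optimal solution, denoted $w_{F,\phi}(z)$, and $w_{F,\phi}(z)\in S^\circ$. 2. The solution map admits the representation $$w_{F,\phi}(z)=\bar w+N\nabla\psi^*(-Bz),\qquad z\in\mathbb R^k.$$ Consequently, $w_{F,\phi}$ is differentiable, with Jacobian $$Jw_{F,\phi}(z)=-N\nabla^2\psi^*(-Bz)B.$$ 3. The map $w_{F,\phi}$ is Lipschitz continuous. In particular, for all $z_1,z_2\in\mathbb R^k$, $$\|w_{F,\phi}(z_1)-w_{F,\phi}(z_2)\|_2\le\frac{\|B\|_2}{\mu}\|z_1-z_2\|_2\le\frac{\|F\|_2}{\mu}\|z_1-z_2\|_2.$$ 4. The image of $w_{F,\phi}$ is $S^\circ$. If $k=r$, then $w_{F,\phi}$ is bijective from $\mathbb R^r$ onto $S^\circ$, and its inverse $w_{F,\phi}^{-1}$ is continuous and satisfies $$w_{F,\phi}^{-1}(\bar w+Ny)=-B^{-1}\nabla\psi(y),\qquad y\in Y.$$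 If, in addition (to $k=r$), $\psi\in C^{m}(Y)$ for some integer $m\ge2$, then $w_{F,\phi}\in C^{m-1}(\mathbb R^r)$ and $w_{F,\phi}^{-1}\in C^{m-1}(S^\circ)$.
   Context: Setting. $S\subseteq\mathbb R^n$ is a nonempty closed convex set with affine hull $\operatorname{aff}(S)=\{w\in\mathbb R^n:Aw=b\}$, where $A\in\mathbb R^{p\times n}$ has full row rank and $0\le p\le n-1$ (if $S$ is full-dimensional, $p=0$, $A$ is absent and $\operatorname{aff}(S)=\mathbb R^n$). $S^\circ$ denotes the relative interior of $S$ (and likewise $(\cdot)^\circ$ for other sets). Put $r=n-p$, let $N\in\mathbb R^{n\times r}$ be a matrix whose columns form an orthonormal basis of $\ker(A)$ (of $\mathbb R^n$ if $A$ is absent), and fix any $\bar w\in S^\circ$. Define $Y:=\{y\in\mathbb R^r:\bar w+Ny\in S^\circ\}$. Let $F\in\mathbb R^{n\times k}$ with $k\ge r$ and $B:=N^\top F\in\mathbb R^{r\times k}$, and assume $\operatorname{rank}(B)=r$. Admissible Legendre regularizer. For an extended-real-valued function $\phi$, $\operatorname{dom}(\phi)=\{w:\phi(w)<+\infty\}$. A proper lower semicontinuous convex function $\phi:\mathbb R^n\to\mathbb R\cup\{+\infty\}$ is an admissible Legendre regularizer for $S$ if $S^\circ=(\operatorname{dom}(\phi))^\circ$ and the reduced function $\psi(y):=\phi(\bar w+Ny)$ on $\mathbb R^r$ satisfies: (1) $\psi$ is $\mu$-strongly convex for some $\mu>0$; (2) $\psi$ is essentially smooth, i.e., $\psi$ is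 differentiable on $Y$, and $\lim_{i\to\infty}|\nabla\psi(y^i)|=+\infty$ for every sequence $\{y^i\}\subseteq Y$ converging to a boundary point of $Y$; (3) the convex conjugate $\psi^*(u)=\sup_{y}\{\langle u,y\rangle-\psi(y)\}$ is twice differentiable on $\mathbb R^r$. Notation. $\|\cdot\|_2$ is the Euclidean norm for vectors and the spectral (operator) norm for matrices. $C^m(X)$ is the class of functions with continuous partial derivatives up to order $m$ on $X$ (componentwise for vector-valued maps); smoothness on the relatively open set $S^\circ$ is understood through the affine parametrization $y\in Y\mapsto\bar w+Ny\in S^\circ$. *)

(* Defs.v *)
(* Vectors of R^n are column vectors 'cV[R]_n. *)
From HB Require Import structures.
From mathcomp Require Import all_boot all_order all_algebra.
From mathcomp Require Import all_classical all_reals all_analysis.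

Set Implicit Arguments.
Unset Strict Implicit.
Unset Printing Implicit Defensive.

Import Order.TTheory GRing.Theory Num.Theory.
Import numFieldNormedType.Exports.

Local Open Scope classical_set_scope.
Local Open Scope ring_scope.

Section euclidean.
Context {R : realType}.

Definition dot n (u v : 'cV[R]_n) : R := \sum_i u i 0 * v i 0.

(* The library norm `|x| on matrices is the max norm (it induces the same
   topology); enorm and opnorm are the Euclidean and spectral norms. *)
Definition enorm n (x : 'cV[R]_n) : R := Num.sqrt (dot x x).

Definition opnorm m n (M : 'M[R]_(m, n)) : R :=
  sup [set enorm (M *m x) | x in [set x : 'cV[R]_n | enorm x <= 1]].

End euclidean.

Section convex_analysis.
Context {R : realType}.

Definition affine_hull n (C : set 'cV[R]_n) : set 'cV[R]_n :=
  [set x | exists (m : nat) (c : 'I_m -> R) (v : 'I_m -> 'cV[R]_n),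
     [/\ forall i, C (v i), \sum_i c i = 1 & x = \sum_i c i *: v i]].

Definition relint n (C : set 'cV[R]_n) : set 'cV[R]_n :=
  [set x | affine_hull C x /\ \forall y \near x, affine_hull C y -> C y].

Definition edom n (f : 'cV[R]_n -> \bar R) : set 'cV[R]_n :=
  [set x | (f x < +oo)%E].

Definition proper_fun n (f : 'cV[R]_n -> \bar R) : Prop :=
  (forall x, f x != -oo%E) /\ edom f !=set0.

Definition econvex n (f : 'cV[R]_n -> \bar R) : Prop :=
  forall (x y : 'cV[R]_n) (t : R), 0 < t < 1 ->
    (f (t *: x + (1 - t) *: y)%R <= t%:E * f x + (1 - t)%:E * f y)%E.

Definition strongly_convex n (mu : R) (f : 'cV[R]_n -> \bar R) : Prop :=
  forall (x y : 'cV[R]_n) (t : R), 0 < t < 1 ->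
    (f (t *: x + (1 - t) *: y)%R <= t%:E * f x + (1 - t)%:E * f y
        - (mu / 2 * t * (1 - t) * enorm (x - y) ^+ 2)%:E)%E.

Definition conjugate n (f : 'cV[R]_n -> \bar R) (u : 'cV[R]_n) : \bar R :=
  ereal_sup [set ((dot u y)%:E - f y)%E | y in [set: 'cV[R]_n]].

End convex_analysis.

Section calculus.
Context {R : realType}.

Definition evec n (i : 'I_n) : 'cV[R]_n := delta_mx i 0.

Definition gradient n (f : 'cV[R]_n -> R) (x : 'cV[R]_n) : 'cV[R]_n :=
  \col_i 'D_(evec i) f x.

(* The usual Jacobian J i j = d f_i / d x_j, acting on columns from the left;
   the library's 'J f x is its transpose, for maps between row vectors. *)
Definition Jacobian m n (f : 'cV[R]_m -> 'cV[R]_n) (x : 'cV[R]_m) :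
    'M[R]_(n, m) :=
  \matrix_(i, j) 'D_(evec j) (fun z => f z i 0) x.

Definition Hessian n (f : 'cV[R]_n -> R) (x : 'cV[R]_n) : 'M[R]_n :=
  Jacobian (gradient f) x.

(* Since fine sends infinite values to 0, finiteness around x is required. *)
Definition ediff n (f : 'cV[R]_n -> \bar R) (x : 'cV[R]_n) : Prop :=
  (\forall z \near x, f z \is a fin_num) /\ differentiable (fine \o f) x.

Definition egrad n (f : 'cV[R]_n -> \bar R) : 'cV[R]_n -> 'cV[R]_n :=
  gradient (fine \o f).

Definition twice_ediff n (f : 'cV[R]_n -> \bar R) : Prop :=
  forall x, ediff f x /\ differentiable (egrad f) x.

(* Continuous partial derivatives up to order m, for X open: the derivatives are
   those of f on the whole space, which at points of an open X only see f on X. *)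
Fixpoint Cclass n (m : nat) (X : set 'cV[R]_n) (f : 'cV[R]_n -> R) : Prop :=
  (forall x, X x -> {for x, continuous f}) /\
  match m with
  | 0 => True
  | m'.+1 => forall i : 'I_n,
      (forall x, X x -> derivable f x (evec i)) /\
      Cclass m' X (fun x => 'D_(evec i) f x)
  end.

Definition vCclass n q (m : nat) (X : set 'cV[R]_n)
    (f : 'cV[R]_n -> 'cV[R]_q) : Prop :=
  forall i : 'I_q, Cclass m X (fun x => f x i 0).

End calculus.

Section legendre.
Context {R : realType}.

Definition orthonormal_basis_ker p n r (A : 'M[R]_(p, n)) (N : 'M[R]_(n, r)) :
    Prop :=
  N^T *m N = 1%:M /\
  forall w : 'cV[R]_n, A *m w = 0 <-> exists y : 'cV[R]_r, w = N *m y.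

Definition reduced n r (phi : 'cV[R]_n -> \bar R) (wbar : 'cV[R]_n)
    (N : 'M[R]_(n, r)) (y : 'cV[R]_r) : \bar R :=
  phi (wbar + N *m y).

Definition param_domain n r (S : set 'cV[R]_n) (wbar : 'cV[R]_n)
    (N : 'M[R]_(n, r)) : set 'cV[R]_r :=
  [set y | relint S (wbar + N *m y)].

Definition essentially_smooth r (Y : set 'cV[R]_r) (psi : 'cV[R]_r -> \bar R) :
    Prop :=
  (forall y, Y y -> ediff psi y) /\
  forall (y_ : nat -> 'cV[R]_r) (y : 'cV[R]_r),
    (forall i, Y (y_ i)) -> (closure Y `\` interior Y) y ->
    y_ i @[i --> \oo] --> y ->
    enorm (egrad psi (y_ i)) @[i --> \oo] --> +oo.

Definition admissible_legendre n r (S : set 'cV[R]_n) (wbar : 'cV[R]_n)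
    (N : 'M[R]_(n, r)) (phi : 'cV[R]_n -> \bar R) : Prop :=
  let psi := reduced phi wbar N in
  [/\ proper_fun phi, lower_semicontinuous phi, econvex phi,
      relint S = relint (edom phi) &
      [/\ exists2 mu : R, 0 < mu & strongly_convex mu psi,
          essentially_smooth (param_domain S wbar N) psi &
          twice_ediff (conjugate psi)]].

Definition optimal n k (F : 'M[R]_(n, k)) (phi : 'cV[R]_n -> \bar R)
    (z : 'cV[R]_k) : set 'cV[R]_n :=
  [set w | forall v : 'cV[R]_n,
     ((dot (F *m z) w)%:E + phi w <= (dot (F *m z) v)%:E + phi v)%E].

(* The minimizer w_{F,phi}(z); arbitrary when there is none. *)
Definition wsol n k (F : 'M[R]_(n, k)) (phi : 'cV[R]_n -> \bar R)
    (z : 'cV[R]_k) : 'cV[R]_n :=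
  get (optimal F phi z).

End legendre.

(* Main.v *)
(* All computations take place in the coordinates y of aff(S) = wbar + N R^r.
   Since relint S = relint (dom phi), the domain of phi lies in aff(S), so w = wbar + N y
   is optimal for z iff y maximizes <v, .> - psi with v = - B z.  Strong convexity makes
   maximizing sequences Cauchy, whence existence by lower semicontinuity, and it gives
   the Lipschitz bound.  A maximizer y at v is a subgradient of psi^* at v, hence
   y = grad psi^*(v).
   It lies in Y: on the segment y_t from y to an interior point y0, the subgradient
   inequality tested on a ball around y0, together with the minimality of y, bounds
   grad psi(y_t) as y_t -> y, contradicting essential smoothness at a boundary point.
   Thus grad psi : Y -> R^r and grad psi^* are inverse to each other.  For the
   regularity, grad psi^* is differentiable by assumption, so differentiating
   grad psi^* (grad psi y) = y gives J(grad psi^* )(v) = (Hess psi (grad psi^* v))^-1,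
   and one bootstraps. *)
Require Import Defs.
From HB Require Import structures.
From mathcomp Require Import all_boot all_order all_algebra.
From mathcomp Require Import all_classical all_reals all_analysis.
From mathcomp Require Import ring lra.

Set Implicit Arguments.
Unset Strict Implicit.
Unset Printing Implicit Defensive.

Import Order.TTheory GRing.Theory Num.Theory.
Import numFieldNormedType.Exports.

Local Open Scope classical_set_scope.
Local Open Scope ring_scope.

(** * Euclidean and spectral norms *)
Section euclidean_theory.
Context {R : realType}.

Lemma dotC n (u v : 'cV[R]_n) : dot u v = dot v u.
Proof. by apply: eq_bigr => i _; rewrite mulrC. Qed.

Lemma dotDl n (u v w : 'cV[R]_n) : dot (u + v) w = dot u w + dot v w.
Proof. by rewrite /dot -big_split; apply: eq_bigr => i _; rewrite mxE mulrDl. Qed.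

Lemma dotZl n (a : R) (u v : 'cV[R]_n) : dot (a *: u) v = a * dot u v.
Proof. by rewrite /dot mulr_sumr; apply: eq_bigr => i _; rewrite mxE mulrA. Qed.

Lemma dotNl n (u v : 'cV[R]_n) : dot (- u) v = - dot u v.
Proof. by rewrite -scaleN1r dotZl mulN1r. Qed.

Lemma dotBl n (u v w : 'cV[R]_n) : dot (u - v) w = dot u w - dot v w.
Proof. by rewrite dotDl dotNl. Qed.

Lemma dotDr n (u v w : 'cV[R]_n) : dot u (v + w) = dot u v + dot u w.
Proof. by rewrite dotC dotDl ![dot _ u]dotC. Qed.

Lemma dotZr n (a : R) (u v : 'cV[R]_n) : dot u (a *: v) = a * dot u v.
Proof. by rewrite dotC dotZl dotC. Qed.

Lemma dotNr n (u v : 'cV[R]_n) : dot u (- v) = - dot u v.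
Proof. by rewrite dotC dotNl dotC. Qed.

Lemma dotBr n (u v w : 'cV[R]_n) : dot u (v - w) = dot u v - dot u w.
Proof. by rewrite dotDr dotNr. Qed.

Lemma dot0l n (u : 'cV[R]_n) : dot 0 u = 0.
Proof. by rewrite /dot big1// => i _; rewrite mxE mul0r. Qed.

Lemma dot_mulmxl m n (M : 'M[R]_(m, n)) x y :
  dot (M *m x) y = dot x (M^T *m y).
Proof.
rewrite /dot; under eq_bigr do rewrite mxE mulr_suml.
rewrite exchange_big; apply: eq_bigr => j _; rewrite mxE mulr_sumr.
by apply: eq_bigr => i _; rewrite mxE mulrCA mulrA [M i j * _]mulrC.
Qed.

Lemma dot_ge0 n (u : 'cV[R]_n) : 0 <= dot u u.
Proof. by apply: sumr_ge0 => i _; rewrite -expr2 sqr_ge0. Qed.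

Lemma dot_evec n (u : 'cV[R]_n) i : dot u (evec i) = u i 0.
Proof.
rewrite /dot (bigD1 i)//= big1 => [|j ji]; rewrite !mxE ?eqxx ?mulr1 ?addr0//.
by rewrite (negPf ji) mulr0.
Qed.

Lemma enorm_sqr n (x : 'cV[R]_n) : enorm x ^+ 2 = dot x x.
Proof. by rewrite sqr_sqrtr// dot_ge0. Qed.

Lemma enorm_ge0 n (x : 'cV[R]_n) : 0 <= enorm x.
Proof. exact: sqrtr_ge0. Qed.

Lemma enorm0 n : enorm (0 : 'cV[R]_n) = 0.
Proof. by rewrite /enorm dot0l sqrtr0. Qed.

Lemma enormZ n a (x : 'cV[R]_n) : enorm (a *: x) = `|a| * enorm x.
Proof.
by rewrite /enorm dotZl dotZr mulrA sqrtrM -?expr2 ?sqr_ge0// sqrtr_sqr.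
Qed.

Lemma enormB n (x y : 'cV[R]_n) : enorm (x - y) = enorm (y - x).
Proof. by rewrite -opprB -scaleN1r enormZ normrN1 mul1r. Qed.

Lemma dot_eq0 n (x : 'cV[R]_n) : dot x x = 0 -> x = 0.
Proof.
move=> /eqP; rewrite psumr_eq0 => [/allP x0|i _]; last by rewrite -expr2 sqr_ge0.
apply/colP => i; rewrite mxE.
by have := x0 i (mem_index_enum _); rewrite mulf_eq0 orbb => /eqP.
Qed.

Lemma enorm_eq0 n (x : 'cV[R]_n) : enorm x = 0 -> x = 0.
Proof. by move=> x0; apply: dot_eq0; rewrite -enorm_sqr x0 expr0n. Qed.

Lemma enorm_gt0 n (x : 'cV[R]_n) : x != 0 -> 0 < enorm x.
Proof.
move=> x0; rewrite lt_neqAle enorm_ge0 andbT eq_sym.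
by apply: contra_neq x0 => /enorm_eq0.
Qed.

(** For nonzero vectors, expanding the square of [enorm v *: u - enorm u *: v] leaves twice
    |u||v|(|u||v| - <u,v>), which is nonnegative; then divide by |u||v|. *)
Lemma cauchy_schwarz n (u v : 'cV[R]_n) : dot u v <= enorm u * enorm v.
Proof.
have [->|v0] := eqVneq v 0; first by rewrite dotC dot0l enorm0 mulr0.
have [->|u0] := eqVneq u 0; first by rewrite dot0l enorm0 mul0r.
have := dot_ge0 (enorm v *: u - enorm u *: v).
rewrite !(dotBl, dotBr, dotZl, dotZr) -!enorm_sqr [dot v u]dotC.
have := enorm_gt0 u0; have := enorm_gt0 v0.
set a := enorm u; set b := enorm v => b0 a0 h.
have : 0 <= (a * b) * (a * b - dot u v) by lra.
by rewrite pmulr_rge0 ?mulr_gt0// subr_ge0.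
Qed.

Lemma entry_le_norm m n (x : 'M[R]_(m, n)) i j : `|x i j| <= `|x|.
Proof.
by rewrite [leRHS]/Num.Def.normr/= mx_normrE; exact: (le_bigmax _ _ (i, j)).
Qed.

Lemma norm_le_entries m n (x : 'M[R]_(m, n)) C :
  0 <= C -> (forall i j, `|x i j| <= C) -> `|x| <= C.
Proof.
by move=> C0 xC; rewrite [leLHS]/Num.Def.normr/= mx_normrE; exact: bigmax_le.
Qed.

Lemma entry_le_enorm n (x : 'cV[R]_n) i : `|x i 0| <= enorm x.
Proof.
rewrite -(ler_pXn2r (n := 2)) ?nnegrE ?enorm_ge0// enorm_sqr real_normK ?num_real//.
rewrite /dot (bigD1 i)//= -expr2 lerDl sumr_ge0// => j _.
by rewrite -expr2 sqr_ge0.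
Qed.

Lemma norm_le_enorm n (x : 'cV[R]_n) : `|x| <= enorm x.
Proof.
apply: norm_le_entries (enorm_ge0 _) _ => i j.
by rewrite ord1 entry_le_enorm.
Qed.

Lemma enorm_le_entries n (x : 'cV[R]_n) C :
  0 <= C -> (forall i, `|x i 0| <= C) -> enorm x <= Num.sqrt n%:R * C.
Proof.
move=> C0 xC; rewrite -(ler_pXn2r (n := 2)) ?nnegrE ?enorm_ge0 ?mulr_ge0 ?sqrtr_ge0//.
rewrite enorm_sqr exprMn sqr_sqrtr ?ler0n//.
apply: (@le_trans _ _ (\sum_(i < n) C ^+ 2)); last first.
  by rewrite sumr_const card_ord -[leLHS]mulr_natl.
apply: ler_sum => i _; rewrite -expr2 -real_normK ?num_real//.
by rewrite ler_pXn2r ?nnegrE.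
Qed.

(** Shows that the set in [opnorm] is bounded above, so that its [sup] is a genuine least upper
    bound and not a default value. *)
Lemma enorm_mulmx_bounded m n (M : 'M[R]_(m, n)) :
  exists C, forall x, enorm x <= 1 -> enorm (M *m x) <= C.
Proof.
exists (Num.sqrt m%:R * \sum_i \sum_j `|M i j|) => x x1.
apply: enorm_le_entries => [|i].
  by apply: sumr_ge0 => i _; apply: sumr_ge0.
rewrite mxE (le_trans (ler_norm_sum _ _ _))//.
apply: (@le_trans _ _ (\sum_j `|M i j|)).
  apply: ler_sum => j _; rewrite normrM ler_piMr//.
  exact: le_trans (entry_le_enorm _ _) x1.
rewrite [leRHS](bigD1 i)//= lerDl; apply: sumr_ge0 => k _.
exact: sumr_ge0.
Qed.

Lemma enorm_le_opnorm m n (M : 'M[R]_(m, n)) x :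
  enorm (M *m x) <= opnorm M * enorm x.
Proof.
have [->|x0] := eqVneq x 0; first by rewrite mulmx0 !enorm0 mulr0.
have nx := enorm_gt0 x0.
rewrite -ler_pdivrMr// mulrC -[_^-1]gtr0_norm ?invr_gt0// -enormZ scalemxAr.
have [C MC] := enorm_mulmx_bounded M.
apply: ub_le_sup; first by exists C => _ [z z1 <-]; exact: MC.
exists ((enorm x)^-1 *: x) => //=.
by rewrite enormZ gtr0_norm ?invr_gt0// mulVf// gt_eqF.
Qed.

Lemma opnorm_le m n (M : 'M[R]_(m, n)) C :
  (forall x, enorm x <= 1 -> enorm (M *m x) <= C) -> opnorm M <= C.
Proof.
move=> MC; apply: ge_sup => [|_ [x x1 <-]]; last exact: MC.
by exists (enorm (M *m 0)), 0 => //=; rewrite enorm0 ler01.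
Qed.

Lemma opnorm_ge0 m n (M : 'M[R]_(m, n)) : 0 <= opnorm M.
Proof.
have [C MC] := enorm_mulmx_bounded M.
apply: (@le_trans _ _ (enorm (M *m 0))); first exact: enorm_ge0.
apply: ub_le_sup; first by exists C => _ [z z1 <-]; exact: MC.
by exists 0 => //=; rewrite enorm0 ler01.
Qed.

Section orthonormal_columns.
Variables (n r : nat) (N : 'M[R]_(n, r)).
Hypothesis NN : N^T *m N = 1%:M.

Lemma enorm_orthonormal y : enorm (N *m y) = enorm y.
Proof. by rewrite /enorm dot_mulmxl mulmxA NN mul1mx. Qed.

(** The square of |N^T x| is <x, N N^T x>; Cauchy-Schwarz and the isometry [N] bound it by |x||N^T
    x|, and one factor cancels. *)
Lemma enorm_trmx_orthonormal x : enorm (N^T *m x) <= enorm x.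
Proof.
have [->|h] := eqVneq (N^T *m x) 0; first by rewrite enorm0 enorm_ge0.
rewrite -(ler_pM2r (enorm_gt0 h)) -expr2 enorm_sqr dot_mulmxl trmxK.
by rewrite -[X in _ * X]enorm_orthonormal cauchy_schwarz.
Qed.

Lemma opnorm_trmx_orthonormal k (F : 'M[R]_(n, k)) : opnorm (N^T *m F) <= opnorm F.
Proof.
apply: opnorm_le => x x1; rewrite -mulmxA.
rewrite (le_trans (enorm_trmx_orthonormal _))// (le_trans (enorm_le_opnorm _ _))//.
by rewrite ler_piMr// opnorm_ge0.
Qed.

End orthonormal_columns.

End euclidean_theory.

(** * Differential calculus *)
Section directional_derivatives.
Context {R : realType}.

(** Reduces a directional derivative to a derivative in one real variable at 0, where derivability
    and differentiability coincide. *)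
Lemma is_derive_line (V W : normedModType R) (f : V -> W) (x v : V) (df : W) :
  is_derive x v f df <-> is_derive (0 : R) 1 (fun h => f (h *: v + x)) df.
Proof.
have E : 'D_v f x = 'D_1 (fun h : R => f (h *: v + x)) 0.
  rewrite /derive; set g1 := (X in X @ _); set g2 := (X in _ = lim (X @ _)).
  suff -> : g1 = g2 by [].
  by rewrite funeqE /g1 /g2 => h /=; rewrite addr0 scale0r add0r [_%:A]mulr1.
split=> -[df1 df2].
- by split; [move/derivable1P: df1|rewrite -E].
- by split; [apply/derivable1P|rewrite E].
Qed.

Lemma is_derive_along (V W : normedModType R) (f : V -> W) (y w : V) (t : R) :
  derivable f (y + t *: w) w ->
  is_derive t 1 (fun s => f (y + s *: w)) ('D_w f (y + t *: w)).
Proof.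
move=> /derivableP/is_derive_line fw.
suff -> : (fun s => f (y + s *: w)) =
    (fun h => f (h *: w + (y + t *: w))) \o (fun s => s - t).
  apply: (is_derive_line _ _ _ _).2.
  rewrite (_ : (fun h => _) = fun h => f (h *: w + (y + t *: w)))//.
  by apply/funext => h /=; rewrite [_%:A]mulr1 addrK.
by apply/funext => s /=; rewrite addrCA -scalerDl subrK.
Qed.

(** A chain rule with [g] derivable only along [v]: restricted to the line through [x], [g] becomes
    a function of one real variable, hence differentiable, and the chain rule for differentiable
    maps applies. *)
Lemma is_derive_diff_comp (U V W : normedModType R) (g : U -> V) (q : V -> W)
    (x v : U) (dg : V) :
  is_derive x v g dg -> differentiable q (g x) ->
  is_derive x v (q \o g) ('d q (g x) dg).
Proof.
move=> /is_derive_line dgx dq; apply/is_derive_line.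
have [dg1 dg2] := dgx.
set gl := fun h : R => _ in dg1 dg2.
have gl0 : gl 0 = g x by rewrite /gl scale0r add0r.
rewrite -gl0 in dq *.
have dgl : differentiable gl 0 by apply/derivable1_diffP.
have dql : differentiable (q \o gl) 0 by exact: differentiable_comp.
split; first exact: diff_derivable.
transitivity ('d (q \o gl) 0 (1 : R)); first exact: deriveE.
rewrite diff_comp//=; congr ('d q _ _).
by rewrite -dg2 deriveE.
Qed.

Lemma is_derive_scale (V W : normedModType R) (f : V -> W) (x v : V) (df : W)
  (s : R) : is_derive x v f df -> is_derive x (s *: v) f (s *: df).
Proof.
move=> /is_derive_line fv; apply/is_derive_line.
have [fv1 fv2] := fv.
set u := fun h : R => _ in fv1 fv2.
have du : differentiable u 0 by apply/derivable1_diffP.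
rewrite (_ : (fun h => _) = u \o *%R^~ s); last first.
  by apply/funext => h /=; rewrite /u scalerA.
have ds : is_derive (0 : R) 1 ( *%R^~ s) s.
  by split; [exact: diff_derivable|rewrite deriveE// diff_val/= [LHS]mul1r].
have := is_derive_diff_comp ds; move=> /(_ W u); rewrite mul0r => /(_ du).
suff -> : 'd u 0 s = s *: df by [].
by rewrite -fv2 deriveE// -linearZ/= [_%:A]mulr1.
Qed.

(** The derivative is also the limit of the quotients from the right, each at most [c]. Convexity
    supplies such secant bounds. *)
Lemma derive_le_secant (V : normedModType R) (f : V -> R) (x v : V) (c : R) :
  derivable f x v ->
  (forall t, 0 < t < 1 -> f (x + t *: v) - f x <= t * c) -> 'D_v f x <= c.
Proof.
move=> fv fc; rewrite /derive cvg_at_rightE//; apply: limr_le.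
  by case/cvg_ex: fv => l fl; apply/cvg_ex; exists l; exact: cvg_dnbhs_at_right.
near=> t.
have t0 : 0 < t by near: t; exact: nbhs_right_gt.
have t1 : t < 1 by near: t; exact: nbhs_right_lt.
rewrite /= -[_ *: _]/(_ * _) mulrC ler_pdivrMr// [c * t]mulrC.
by rewrite [t *: v + x]addrC fc ?t0.
Unshelve. all: by end_near. Qed.

(** Parametrizing the segment over [0, 1] with direction [s *: e] treats both signs of [s] at
    once. *)
Lemma MVT_line (V : normedModType R) (f : V -> R) (y e : V) (s : R) :
  (forall c : R, `|c| <= `|s| -> derivable f (y + c *: e) e) ->
  exists2 c, `|c| <= `|s| & f (y + s *: e) - f y = s * 'D_e f (y + c *: e).
Proof.
move=> fd.
have bd (t : R) : 0 <= t <= 1 -> `|t * s| <= `|s|.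
  by move=> /andP[t0 t1]; rewrite normrM ler_piMl// ger0_norm.
have ds t : t \in `[0, 1] ->
    is_derive (t : R) 1 (fun t : R => f (y + t *: (s *: e)))
      (s * 'D_e f (y + (t * s) *: e)).
  rewrite in_itv/= => /bd ts.
  have := is_derive_scale s (derivableP (fd _ ts)).
  rewrite -scalerA => -[h1 h2]; rewrite -[s * _]h2.
  exact: is_derive_along.
pose g (t : R) : R := f (y + t *: (s *: e)).
pose dg (t : R) : R := s * 'D_e f (y + (t * s) *: e).
have gd (t : R) : t \in `]0, 1[ -> is_derive t 1 g (dg t).
  by move=> t01; apply: ds; exact: subset_itv_oo_cc t01.
have gc : {within `[0, 1], continuous g}.
  by apply: derivable_within_continuous => t /ds[].
have [c] := MVT ltr01 gd gc.
rewrite in_itv/= => /andP[c0 c1]; rewrite /g /dg scale0r addr0 scale1r subr0 mulr1 => ->.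
by exists (c * s) => //; apply: bd; rewrite !ltW.
Qed.

End directional_derivatives.

(** * Continuity and differentiability of matrix-valued maps, entry by entry *)

Section matrix_valued.
Context {R : realType}.

Lemma differentiable_mx (V : normedModType R) m n (f : V -> 'M[R]_(m, n)) x :
  (forall i j, differentiable (fun y => f y i j) x) -> differentiable f x.
Proof.
move=> fd.
rewrite (_ : f = \sum_i \sum_j (fun y => f y i j *: delta_mx i j)); last first.
  apply/funext => y; rewrite {1}[f y]matrix_sum_delta fct_sumE.
  by apply: eq_bigr => i _; rewrite fct_sumE.
by do 2 apply: differentiable_sum => ?; exact: differentiableZl.
Qed.

Lemma differentiable_entry (V : normedModType R) m n (f : V -> 'M[R]_(m, n)) x i j :
  differentiable f x -> differentiable (fun y => f y i j) x.
Proof.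
move=> fd.
apply: (@differentiable_comp _ _ _ _ f (fun M : 'M[R]_(m, n) => M i j)) => //.
exact: differentiable_coord.
Qed.

Lemma differentiable_mulmx (V : normedModType R) m n p (M : 'M[R]_(m, n))
    (f : V -> 'M[R]_(n, p)) x :
  differentiable f x -> differentiable (fun y => M *m f y) x.
Proof.
move=> fd; apply: differentiable_mx => i j.
rewrite (_ : (fun _ => _) = \sum_k (M i k *: (fun y => f y k j))); last first.
  by apply/funext => y; rewrite mxE fct_sumE.
by apply: differentiable_sum => k; apply: differentiableZ; exact: differentiable_entry.
Qed.

Lemma continuous_mx (T : topologicalType) m n (f : T -> 'M[R]_(m, n)) x :
  (forall i j, {for x, continuous (fun y => f y i j)}) -> {for x, continuous f}.
Proof.
move=> fc; rewrite /prop_for /continuous_at.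
apply/(@cvgrPdist_le R 'M[R]_(m, n)) => e e0; near=> y.
apply: norm_le_entries; first exact: ltW.
suff : forall ij : 'I_m * 'I_n, `|(f x - f y) ij.1 ij.2| <= e.
  by move=> h i j; exact: (h (i, j)).
near: y; apply: filter_forall => -[i j]/=.
by have /cvgrPdist_le/(_ _ e0) := fc i j; apply: filterS => y; rewrite !mxE.
Unshelve. all: by end_near. Qed.

Lemma continuous_entry (T : topologicalType) m n (f : T -> 'M[R]_(m, n)) x i j :
  {for x, continuous f} -> {for x, continuous (fun y => f y i j)}.
Proof.
move=> fc.
apply: (@continuous_comp _ _ _ f (fun M : 'M[R]_(m, n) => M i j)) => //.
exact: coord_continuous.
Qed.

Lemma continuous_mulmx (T : topologicalType) m n p (M : 'M[R]_(m, n))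
    (f : T -> 'M[R]_(n, p)) x :
  {for x, continuous f} -> {for x, continuous (fun y => M *m f y)}.
Proof.
move=> fc; apply: (@continuous_comp _ _ _ f (mulmx M)); first exact: fc.
apply: (@differentiable_continuous R 'M[R]_(n, p) 'M[R]_(m, p)).
apply: (@differentiable_mulmx 'M[R]_(n, p) m n p M id).
exact: ex_diff.
Qed.

End matrix_valued.

(** * Gradients, and Fréchet differentiability from continuous partial derivatives *)

Section gradients.
Context {R : realType}.

(** Lets [dot u] serve as the linear map in [differentiable_linear_approx]. *)
HB.instance Definition _ n (u : 'cV[R]_n) :=
  GRing.isLinear.Build R 'cV[R]_n R _ (dot u)
    (fun a x y => eq_trans (dotDr _ _ _) (f_equal (+%R^~ _) (dotZr _ _ _))).

Lemma dot_continuous n (u : 'cV[R]_n) : continuous (dot u).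
Proof.
move=> x; rewrite (_ : dot u = \sum_i (u i 0 *: (fun y : 'cV[R]_n => y i 0))).
  apply: differentiable_continuous; apply: differentiable_sum => i.
  by apply: differentiableZ; exact: differentiable_coord.
by apply/funext => y; rewrite fct_sumE.
Qed.

Lemma cV_sum_evec n (v : 'cV[R]_n) : v = \sum_i v i 0 *: evec i.
Proof. by rewrite {1}[v]matrix_sum_delta; apply: eq_bigr => i _; rewrite big_ord1. Qed.

Lemma diff_gradient n (f : 'cV[R]_n -> R) x v :
  differentiable f x -> 'd f x v = dot (gradient f x) v.
Proof.
move=> fd; rewrite {1}[v]cV_sum_evec linear_sum; apply: eq_bigr => i _.
by rewrite linearZ/= mxE -deriveE// mulrC.
Qed.

Lemma derive_gradient n (f : 'cV[R]_n -> R) x v :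
  differentiable f x -> 'D_v f x = dot (gradient f x) v.
Proof. by move=> fd; rewrite deriveE// diff_gradient. Qed.

Lemma differentiable_linear_approx (V W : normedModType R) (f : V -> W) x
    (L : {linear V -> W}) :
  continuous L ->
  (forall e, 0 < e -> \forall h \near (0 : V),
     `|f (h + x) - f x - L h| <= e * `|h|) ->
  differentiable f x.
Proof.
move=> Lc fL.
have E : f \o shift x = cst (f x) + L +o_ 0 id.
  apply/eqaddoP => e e0; have := fL e e0; apply: filterS => h.
  by rewrite /= opprD addrA.
by apply/diff_locallyP; rewrite (diff_unique Lc E).
Qed.

(** The increment splits into moves parallel to the axes. The mean value theorem turns each into a
    partial derivative at a point near [x], which continuity at [x] compares with the partial
    derivative at [x]. *)
Lemma differentiable_C1 n (f : 'cV[R]_n -> R) x :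
  (\forall y \near x, forall i, derivable f y (evec i)) ->
  (forall i, {for x, continuous (fun y => 'D_(evec i) f y)}) ->
  differentiable f x.
Proof.
move=> fd fc; apply: (@differentiable_linear_approx _ _ _ _ (dot (gradient f x))).
  exact: dot_continuous.
move=> e e0.
(* The n coordinate errors must add up to at most e; [n.+1] keeps the quotient meaningful for n =
   0. *)
have e'0 : 0 < e / n.+1%:R by rewrite divr_gt0.
have [d /= d0 fxd] : exists2 d, 0 < d & forall y, `|y - x| < d ->
    forall i, derivable f y (evec i) /\
      `|'D_(evec i) f y - 'D_(evec i) f x| <= e / n.+1%:R.
  have : \forall y \near x, forall i, derivable f y (evec i) /\
      `|'D_(evec i) f y - 'D_(evec i) f x| <= e / n.+1%:R.
    near=> y.
    suff h : forall i, `|'D_(evec i) f y - 'D_(evec i) f x| <= e / n.+1%:R.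
      by move=> i; split; [move: i; near: y|exact: h].
    near: y; apply: filter_forall => i.
    by have /cvgrPdist_le/(_ _ e'0) := fc i; apply: filterS => y; rewrite distrC.
  move=> /nbhs_normP[d /= d0 xd]; exists d => // y yx.
  by apply: xd; rewrite /= distrC.
have := @nbhs0_lt _ 'cV[R]_n _ d0; apply: filterS => h hd.
(* h truncated to its first k coordinates: the increment of f is telescoped along c. *)
pose c (k : nat) : 'cV[R]_n := \col_(i < n) (if (i < k)%N then h i 0 else 0).
have c0 : c 0%N = 0 by apply/colP => i; rewrite !mxE.
have cn : c n = h by apply/colP => i; rewrite !mxE ltn_ord.
have cS (i : 'I_n) : c i.+1 = c i + h i 0 *: evec i.
  apply/colP => j; rewrite !mxE eqxx andbT ltnS leq_eqVlt.
  have [->|ji] := eqVneq j i; first by rewrite eqxx ltnn/= add0r mulr1.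
  by rewrite (inj_eq val_inj) (negPf ji)/= mulr0 addr0.
have -> : f (h + x) - f x = \sum_(i < n) (f (x + c i.+1) - f (x + c i)).
  rewrite -(big_mkord xpredT (fun i => f (x + c i.+1) - f (x + c i))).
  by rewrite telescope_sumr// cn c0 addr0 [x + h]addrC.
rewrite /dot -sumrB (le_trans (ler_norm_sum _ _ _))//.
apply: (@le_trans _ _ (\sum_(i < n) e / n.+1%:R * `|h|)); last first.
  rewrite sumr_const card_ord -[leLHS]mulr_natl mulrA ler_wpM2r//.
  by rewrite mulrA ler_pdivrMr// mulrC ler_wpM2l ?ltW// ltr_nat.
apply: ler_sum => i _.
have close (t : R) : `|t| <= `|h i 0| -> `|x + c i + t *: evec i - x| < d.
  move=> th; rewrite addrC !addrA addNr add0r; apply: le_lt_trans hd.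
  apply: norm_le_entries => // j k; rewrite ord1 !mxE eqxx andbT.
  have [->|ji] := eqVneq j i.
    by rewrite ltnn add0r mulr1 (le_trans th)// entry_le_norm.
  by rewrite mulr0 addr0; case: ifP; rewrite ?normr0// entry_le_norm.
have [t th] := MVT_line (fun t th => (fxd _ (close t th) i).1).
rewrite -addrA -cS => ->.
rewrite mxE [_ * h i 0]mulrC -mulrBr normrM mulrC.
by rewrite ler_pM//; [exact: (fxd _ (close t th) i).2|exact: entry_le_norm].
Unshelve. all: by end_near. Qed.

Lemma is_derive_gradient_comp n (V : normedModType R) (q : 'cV[R]_n -> R)
    (g : V -> 'cV[R]_n) x v :
  (forall l, derivable (fun y => g y l 0) x v) -> differentiable q (g x) ->
  is_derive x v (q \o g)
    (\sum_l 'D_(evec l) q (g x) * 'D_v (fun y => g y l 0) x).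
Proof.
move=> gd qd.
have gD : derivable g x v by apply/derivable_mxP => i j; rewrite ord1.
have := is_derive_diff_comp (derivableP gD) qd.
rewrite diff_gradient// derive_mx// /dot.
by under eq_bigr do rewrite !mxE.
Qed.

End gradients.

(** * Strongly convex functions and conjugates *)
Section first_order.
Context {R : realType}.

(** With [h] the difference of the two vectors, the affine minorant tested along a small negative
    multiple of [h] gives <h, h> <= 0. *)
Lemma gradient_unique n (f : 'cV[R]_n -> R) x g :
  differentiable f x ->
  (\forall y \near x, f x + dot g (y - x) <= f y) -> gradient f x = g.
Proof.
move=> fd /nbhs_normP[d /= d0 fg].
set h := gradient f x - g.
have [s s0 sh] : exists2 s, 0 < s & `|s *: h| < d.
  exists (d / (2 * (`|h| + 1))); first by rewrite divr_gt0 ?mulr_gt0 ?ltr_wpDl.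
  rewrite normrZ gtr0_norm ?divr_gt0 ?mulr_gt0 ?ltr_wpDl//.
  rewrite mulrAC ltr_pdivrMr ?mulr_gt0 ?ltr_wpDl// ltr_pM2l//.
  by have := normr_ge0 h; lra.
pose w := - (s *: h).
have : 'D_w (- f) x <= - dot g w.
  apply: derive_le_secant; first exact/derivableN/diff_derivable.
  move=> t /andP[t0 t1].
  have E : x + t *: w - x = t *: w by rewrite addrC addKr.
  have tw : t * `|s *: h| < d by apply: le_lt_trans sh; rewrite ler_piMl// ltW.
  have := fg (x + t *: w); rewrite /= distrC E normrZ gtr0_norm// normrN dotZr.
  move=> /(_ tw) h1; rewrite -[(- f) _]/(- f _) -[(- f) x]/(- f x) mulrN; lra.
rewrite deriveN; last exact: diff_derivable.
rewrite derive_gradient// lerN2 -subr_ge0 -dotBl -/h /w dotNr dotZr oppr_ge0.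
rewrite pmulr_rle0// => hh.
by apply/subr0_eq/dot_eq0/le_anti; rewrite -/h hh dot_ge0.
Qed.

End first_order.

(** * Maximizers of [dot v - psi] for strongly convex [psi]: growth, stability, existence *)

Section strongly_convex_conjugate.
Context {R : realType} (n : nat) (psi : 'cV[R]_n -> \bar R) (mu : R).
Hypotheses (mu0 : 0 < mu) (psi_Ny : forall y, psi y != -oo%E).
Hypotheses (psi_sc : strongly_convex mu psi).
Local Notation P := (fine \o psi).
Local Notation D := (edom psi).

Lemma edomE y : D y -> psi y = (P y)%:E.
Proof.
rewrite /edom/= => Dy; rewrite fineK// fin_numE psi_Ny/=.
by rewrite lt_eqF.
Qed.

Lemma edom_fine_le y c : (psi y <= c%:E)%E -> D y /\ P y <= c.
Proof.
move=> yc; have Dy : D y by exact: le_lt_trans yc (ltry _).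
by split => //; rewrite -lee_fin -edomE.
Qed.

Lemma strongly_convex_fine x y t : D x -> D y -> 0 < t < 1 ->
  D (t *: x + (1 - t) *: y) /\
  P (t *: x + (1 - t) *: y) <=
    t * P x + (1 - t) * P y - mu / 2 * t * (1 - t) * enorm (x - y) ^+ 2.
Proof.
move=> Dx Dy /psi_sc => /(_ x y); rewrite (edomE Dx) (edomE Dy) => h.
by apply: edom_fine_le; exact: h.
Qed.

Lemma convex_fine_segment x y t : D x -> D y -> 0 < t < 1 ->
  D (x + t *: (y - x)) /\ P (x + t *: (y - x)) - P x <= t * (P y - P x).
Proof.
move=> Dx Dy t01; have [] := strongly_convex_fine Dy Dx t01.
have -> : t *: y + (1 - t) *: x = x + t *: (y - x).
  by rewrite scalerBl scale1r scalerBr addrCA.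
move=> Dz; split => //; have /andP[t0 t1] := t01.
have : 0 <= mu / 2 * t * (1 - t) * enorm (y - x) ^+ 2.
  have t1' : 0 <= 1 - t by lra.
  by apply: mulr_ge0 (sqr_ge0 _); do ![apply: mulr_ge0 => //]; exact: ltW.
lra.
Qed.

(** Attainment of the supremum defining the conjugate at [v], in real numbers; equivalently, [v] is
    a subgradient of [psi] at [y]. *)
Definition is_argmax (v y : 'cV[R]_n) : Prop :=
  D y /\ forall z, D z -> dot v z - P z <= dot v y - P y.

(** Comparing [y] with a point t z + (1 - t) y by strong convexity and dividing by t gives the bound
    with an extra factor 1 - t, which is removed by varying t. *)
Lemma argmax_growth v y z : is_argmax v y -> D z ->
  mu / 2 * enorm (y - z) ^+ 2 <= (dot v y - P y) - (dot v z - P z).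
Proof.
move=> [Dy ymax] Dz.
have key t : 0 < t < 1 -> (1 - t) * (mu / 2 * enorm (y - z) ^+ 2) <=
    (dot v y - P y) - (dot v z - P z).
  move=> t01; have [Dw Pw] := strongly_convex_fine Dz Dy t01.
  have := ymax _ Dw; rewrite dotDr !dotZr [enorm (y - z)]enormB.
  have /andP[t0 t1] := t01.
  set E := enorm _ ^+ 2 in Pw *; set Q := P (t *: z + _) in Pw * => h.
  rewrite -(ler_pM2l t0); lra.
set b := mu / 2 * _ in key *; set a := _ - _ - _ in key *.
have b0 : 0 <= b by rewrite mulr_ge0 ?sqr_ge0// divr_ge0// ltW.
clearbody a b; apply: contrapT => /negP; rewrite -ltNge => ab.
(* The instance t = 1/2 shows a >= b/2 >= 0, so that b > a forces b > 0. *)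
have a2 : (1 - 2^-1) * b <= a by apply: key; lra.
have b1 : 0 < b by lra.
(* This t turns (1 - t) b into the midpoint of a and b, which exceeds a. *)
have : (1 - (b - a) / (2 * b)) * b <= a.
  apply: key; rewrite divr_gt0 ?mulr_gt0 ?subr_gt0//=.
  by rewrite ltr_pdivrMr ?mulr_gt0//; lra.
have -> : (1 - (b - a) / (2 * b)) * b = (a + b) / 2.
  by field; rewrite gt_eqF.
lra.
Qed.

(** Adding the two growth inequalities cancels the values of [psi] and leaves mu |y1 - y2|^2 <= <v1
    - v2, y1 - y2>; Cauchy-Schwarz finishes. *)
Lemma argmax_lipschitz v1 v2 y1 y2 : is_argmax v1 y1 -> is_argmax v2 y2 ->
  mu * enorm (y1 - y2) <= enorm (v1 - v2).
Proof.
move=> m1 m2; have [D1 _] := m1; have [D2 _] := m2.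
have := argmax_growth m1 D2; have := argmax_growth m2 D1.
rewrite [enorm (y2 - _)]enormB => h1 h2.
have h : mu * enorm (y1 - y2) ^+ 2 <= dot (v1 - v2) (y1 - y2).
  by rewrite dotBl !dotBr; lra.
have [E|y12] := eqVneq (y1 - y2) 0; first by rewrite E enorm0 mulr0 enorm_ge0.
rewrite -(ler_pM2r (enorm_gt0 y12)) -mulrA -expr2.
exact: le_trans h (cauchy_schwarz _ _).
Qed.

Lemma conjugate_ge v z : D z -> ((dot v z - P z)%:E <= conjugate psi v)%E.
Proof.
by move=> Dz; apply: ereal_sup_ubound; exists z => //; rewrite (edomE Dz).
Qed.

Lemma conjugate_argmax v y : is_argmax v y ->
  conjugate psi v = (dot v y - P y)%:E.
Proof.
move=> [Dy ymax]; apply/le_anti; rewrite conjugate_ge// andbT.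
apply: ge_ereal_sup => _ [z _ <-].
have [Dz|nDz] := pselect (D z); first by rewrite (edomE Dz) lee_fin ymax.
suff -> : psi z = +oo%E by rewrite leNye.
by apply/eqP; rewrite eq_le leey/= leNgt; apply/negP.
Qed.

(** The affine function u -> <u, y> - P y minorizes the conjugate and touches it at [v], so
    [gradient_unique] applies. *)
Lemma argmax_gradient_conjugate v y :
  (forall u, conjugate psi u \is a fin_num) ->
  differentiable (fine \o conjugate psi) v -> is_argmax v y ->
  egrad (conjugate psi) v = y.
Proof.
move=> fin dv m; apply: gradient_unique => //; near=> u.
have [Dy _] := m.
rewrite /= (conjugate_argmax m)/= -lee_fin fineK//.
rewrite (_ : _ + _ = dot u y - P y) ?conjugate_ge//.
by rewrite dotBr ![dot y _]dotC /=; lra.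
Unshelve. all: by end_near. Qed.

Lemma argmax_exists v : lower_semicontinuous psi ->
  conjugate psi v \is a fin_num -> exists y, is_argmax v y.
Proof.
move=> lsc fin; set c := fine (conjugate psi v).
have cE : conjugate psi v = c%:E by rewrite fineK.
have Hc z : D z -> dot v z - P z <= c.
  by move=> /(conjugate_ge v); rewrite cE.
have app (k : nat) : exists z, D z /\ c - k.+1%:R^-1 < dot v z - P z.
  have : ((c - k.+1%:R^-1)%:E < conjugate psi v)%E.
    by rewrite cE lte_fin ltrBlDr ltrDl.
  move=> /ereal_sup_gt[_ [z _ <-] cz]; exists z.
  have Dz : D z.
    rewrite /edom/= ltey; apply: contraTneq cz => ->.
    by rewrite -leNgt leNye.
  by split => //; move: cz; rewrite (edomE Dz) -EFinB lte_fin.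
have [y_ y_P] := choice app.
(* Both points are optimal up to 1/(k+1) because k <= m; the 8 comes from the midpoint gain mu/8
   times the squared distance. *)
have dist k e : 0 < e -> forall m, (k <= m)%N ->
   8 * k.+1%:R^-1 / mu <= e ^+ 2 -> `|y_ k - y_ m| < e.
  move=> e0 m km ke.
  have [Dk ck] := y_P k; have [Dm cm] := y_P m.
  have half01 : 0 < (2^-1 : R) < 1 by lra.
  (* Strong convexity at the midpoint of two almost-maximizers bounds their distance. *)
  have [Dw Pw] := strongly_convex_fine Dk Dm half01.
  have := Hc _ Dw; rewrite dotDr !dotZr.
  have mk : m.+1%:R^-1 <= k.+1%:R^-1 :> R by rewrite lef_pV2 ?posrE// ler_nat.
  set Q := P (2^-1 *: _ + _) in Pw *; set E := enorm _ ^+ 2 in Pw * => h.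
  have : mu * E < 8 * k.+1%:R^-1.
    by move: mk ck cm Pw h => /=; move: (k.+1%:R^-1) (m.+1%:R^-1) => ? ?; lra.
  rewrite -ltr_pdivlMl// mulrC => E8.
  apply: le_lt_trans (norm_le_enorm _) _.
  rewrite -(ltr_pXn2r (n := 2)) ?nnegrE ?enorm_ge0 ?ltW//.
  exact: lt_le_trans E8 ke.
have small e : 0 < e -> \forall k \near \oo, k.+1%:R^-1 < e :> R.
  by move=> e0; exact: near_infty_natSinv_lt (PosNum e0).
have cvy : cvg (y_ @ \oo).
  apply: cauchy_cvg; apply: cauchy_exP => e e0.
  have e2 : 0 < e ^+ 2 * mu / 8 by rewrite !mulr_gt0 ?exprn_gt0 ?invr_gt0.
  have [k _ /(_ k (leqnn k)) /= kP] := small _ e2.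
  exists (y_ k); exists k => // m /= km; rewrite -ball_normE/=.
  apply: dist => //; rewrite ler_pdivrMr//.
  by move: kP; rewrite ltr_pdivlMr//; move: (k.+1%:R^-1) => ?; lra.
set l := lim (y_ @ \oo) in cvy.
(* If [psi l] exceeded the bound by more than e, lower semicontinuity would carry the excess to
   [y_ k] for large k, against the near-optimality of [y_ k]. *)
have psil : (psi l <= (dot v l - c)%:E)%E.
  apply/lee_addgt0Pr => e e0; rewrite -EFinD leNgt; apply/negP => /lsc[V Vl lV].
  have e2 : 0 < e / 2 by rewrite divr_gt0.
  have : \forall k \near \oo, False.
    near=> k.
    have [Dk ck] := y_P k.
    have kV : V (y_ k) by near: k; exact: cvy.
    have ke : k.+1%:R^-1 < e / 2 by near: k; exact: small.
    have kl : `|dot v l - dot v (y_ k)| < e / 2.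
      near: k; have : dot v (y_ k) @[k --> \oo] --> dot v l.
        by apply: continuous_cvg; [exact: dot_continuous|exact: cvy].
      by move=> /cvgrPdist_lt; apply.
    have := lV _ kV; rewrite (edomE Dk) lte_fin.
    move: kl ck ke; rewrite ltr_norml /=; move: (k.+1%:R^-1) => ? /andP[]; lra.
  by move=> /filter_ex[].
have [Dl Pl] := edom_fine_le psil.
by exists l; split => // z Dz; apply: le_trans (Hc _ Dz) _; lra.
Unshelve. all: by end_near. Qed.

End strongly_convex_conjugate.

(** Here c, a, b stand for the values of a function at a point and at its neighbours at distance s
    on either side, c', a', b' for those at a nearby point, and d0, d1 for the derivatives. Moving
    the point changes each quotient by less than e/2. *)
Lemma difference_quotient_squeeze (K : realFieldType) (s e d0 d1 a b c a' b' c' : K) :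
  0 < s -> `|d0 - (a - c) / s| < e / 2 -> `|d0 - (c - b) / s| < e / 2 ->
  `|a - a'| < e / 4 * s -> `|b - b'| < e / 4 * s -> `|c - c'| < e / 4 * s ->
  (c' - b') / s <= d1 <= (a' - c') / s -> `|d0 - d1| <= e.
Proof.
move=> s0; set u := (a - c) / s; set w := (c - b) / s.
have ua : a = c + u * s by rewrite divfK ?gt_eqF// addrC subrK.
have wb : b = c - w * s by rewrite divfK ?gt_eqF// opprB addrC subrK.
rewrite ler_pdivrMr// ler_pdivlMr// !ltr_norml ler_norml ua wb.
clearbody u w.
move=> /andP[u1 u2] /andP[w1 w2] /andP[a1 a2] /andP[b1 b2] /andP[c1 c2] /andP[d1l d1r].
have us : u * s < (d0 + e / 2) * s by rewrite ltr_pM2r//; lra.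
have ws : (d0 - e / 2) * s < w * s by rewrite ltr_pM2r//; lra.
clear u1 u2 w1 w2; apply/andP; split; rewrite -(ler_pM2r s0).
  by clear b1 b2 d1l ws; lra.
by clear a1 a2 d1r us; lra.
Qed.

(** * Gradients on the open domain [Y], location of maximizers, continuity of the partials *)

Section interior_differentiability.

Lemma cvg_addr_cst (K : numFieldType) (V : normedModType K) (y a : V) :
  x + a @[x --> y] --> y + a.
Proof. by apply: (@cvgD _ _ _ (nbhs y) _ id (cst a) y a cvg_id); exact: cvg_cst. Qed.

Context {R : realType} (n : nat) (psi : 'cV[R]_n -> \bar R) (mu : R).
Hypotheses (mu0 : 0 < mu) (psi_Ny : forall y, psi y != -oo%E).
Hypotheses (psi_sc : strongly_convex mu psi).
Variable Y : set 'cV[R]_n.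
Hypotheses (YE : Y = interior (edom psi)).
Hypotheses (psi_diff : forall y, Y y -> ediff psi y).
Local Notation P := (fine \o psi).
Local Notation D := (edom psi).

Lemma domain_open : open Y.
Proof. by rewrite YE; exact: open_interior. Qed.

Lemma domain_sub y : Y y -> D y.
Proof. by rewrite YE => /interior_subset. Qed.

Lemma egrad_subgradient y z : Y y -> D z -> dot (egrad psi y) (z - y) <= P z - P y.
Proof.
move=> Yy Dz; have [_ dy] := psi_diff Yy.
rewrite -derive_gradient//; apply: derive_le_secant.
  exact: diff_derivable.
by move=> t t01; have [] := convex_fine_segment mu0 psi_Ny psi_sc (domain_sub Yy) Dz t01.
Qed.

Lemma egrad_is_argmax y : Y y -> is_argmax psi (egrad psi y) y.
Proof.
move=> Yy; split; first exact: domain_sub.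
by move=> z Dz; have := egrad_subgradient Yy Dz; rewrite dotBr; lra.
Qed.

Lemma argmax_egrad v y : Y y -> is_argmax psi v y -> egrad psi y = v.
Proof.
move=> Yy [_ ymax]; apply: gradient_unique; first by case: (psi_diff Yy).
have : nbhs y Y by apply: open_nbhs_nbhs; split => //; exact: domain_open.
apply: filterS => z /domain_sub /ymax; rewrite dotBr /=; lra.
Qed.

Lemma domainP y : Y y <-> nbhs y D.
Proof. by rewrite YE. Qed.

(** The homothety of centre [y] and ratio [t] carries a ball around [y0] inside the domain onto a
    ball around the new point, and convexity keeps the image in the domain. *)
Lemma segment_domain y0 y t : Y y0 -> D y -> 0 < t < 1 -> Y (y + t *: (y0 - y)).
Proof.
move=> /domainP/nbhs_normP[d /= d0 Dd] Dy t01.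
have /andP[t0 t1] := t01.
apply/domainP/(@nbhs_normP _ 'cV[R]_n); exists (t * d); first by rewrite /= mulr_gt0.
move=> z /= zd.
have z0 : D (y0 + t^-1 *: (z - (y + t *: (y0 - y)))).
  apply: Dd => /=; rewrite opprD addNKr normrN normrZ normfV gtr0_norm//.
  by rewrite ltr_pdivrMl// distrC.
have := (convex_fine_segment mu0 psi_Ny psi_sc Dy z0 t01).1.
suff -> : y + t *: (y0 + t^-1 *: (z - (y + t *: (y0 - y))) - y) = z by [].
rewrite addrAC scalerDr scalerA divff ?gt_eqF// scale1r addrA.
by rewrite addrC subrK.
Qed.

Lemma argmax_domain v y : Y !=set0 ->
  (forall (y_ : nat -> 'cV[R]_n) (z : 'cV[R]_n),
    (forall i, Y (y_ i)) -> (closure Y `\` interior Y) z ->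
    y_ i @[i --> \oo] --> z ->
    enorm (egrad psi (y_ i)) @[i --> \oo] --> +oo) ->
  is_argmax psi v y -> Y y.
Proof.
move=> [y0 Yy0] blowup m; have [Dy ymax] := m.
apply: contrapT => nYy.
(* The shift by 2 puts every [t i] strictly between 0 and 1, including i = 0. *)
pose t (i : nat) : R := i.+2%:R^-1.
have t0 i : 0 < t i by rewrite invr_gt0.
have t01 i : 0 < t i < 1 by rewrite t0 invf_lt1// ltr1n.
pose y_ i := y + t i *: (y0 - y).
have Yy_ i : Y (y_ i) by exact: segment_domain.
have cvt : t i @[i --> \oo] --> (0 : R).
  by have := @cvg_harmonic R; rewrite -cvg_shiftS.
have cvy : y_ i @[i --> \oo] --> y.
  rewrite -[X in _ --> X]addr0 -[X in _ + X](scale0r (y0 - y)).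
  by apply: cvgD; [exact: cvg_cst|apply: cvgZr_tmp].
have cly : (closure Y `\` interior Y) y.
  split; last by move=> /interior_subset.
  by move=> B /cvy [N _ /(_ N (leqnn N)) /= BN]; exists (y_ N).
have := blowup _ _ Yy_ cly cvy.
have [_ /differentiable_continuous P0] := psi_diff Yy0.
have [d d0 Pd] : exists2 d, 0 < d & forall z, `|y0 - z| < d ->
    D z /\ P z - dot v z <= P y0 - dot v y0 + 1.
  have : \forall z \near y0, D z /\ P z - dot v z <= P y0 - dot v y0 + 1.
    near=> z; split.
      by near: z; exact/domainP.
    have h1 : `|P y0 - P z| < 2^-1.
      by near: z; move/cvgrPdist_lt: P0; apply; rewrite invr_gt0.
    have h2 : `|dot v y0 - dot v z| < 2^-1.
      near: z; have /cvgrPdist_lt := @dot_continuous R n v y0; apply.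
      by rewrite invr_gt0.
    by move: h1 h2; rewrite !ltr_norml /= => /andP[? ?] /andP[? ?]; lra.
  by move=> /nbhs_normP[d d0 dP]; exists d => // z /dP.
(* The component of egrad psi (y_ i) - v along y0 - y is nonnegative by minimality
   of y, so testing the subgradient inequality at y0 + e controls all directions e. *)
pose K := P y0 - dot v y0 + 1 - (P y - dot v y).
have bnd i e : `|e| < d -> dot (egrad psi (y_ i) - v) e <= K.
  move=> ed.
  have [De Pe] : D (y0 + e) /\ P (y0 + e) - dot v (y0 + e) <= P y0 - dot v y0 + 1.
    by apply: Pd; rewrite opprD addNKr normrN.
  have := egrad_subgradient (Yy_ i) De.
  have := egrad_subgradient (Yy_ i) Dy.
  have := ymax _ (domain_sub (Yy_ i)).
  have -> : y - y_ i = - (t i *: (y0 - y)) by rewrite /y_ opprD addNKr.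
  have -> : y0 + e - y_ i = e + (1 - t i) *: (y0 - y).
    by rewrite scalerBl scale1r /y_ opprD !addrA [e + y0]addrC.
  move: Pe; rewrite /K dotNr !dotDr !dotZr dotBl.
  set g := dot (egrad _ _) (y0 - y); set w := dot v (y0 - y).
  have -> : dot v y0 = w + dot v y by rewrite /w dotBr subrK.
  have /andP[ti0 ti1] := t01 i.
  set Q := P (y_ i) => h1 h2 h3 h4.
  have h5 : 0 <= g - w by rewrite -(pmulr_rge0 _ ti0) mulrBr; lra.
  have h6 : 0 <= (1 - t i) * (g - w) by rewrite mulr_ge0// subr_ge0 ltW.
  lra.
pose C := enorm v + K / (d / 2).
have d20 : 0 < d / 2 by rewrite divr_gt0.
have K0 : 0 <= K.
  by have := bnd 0%N 0; rewrite normr0 => /(_ d0); rewrite dotC dot0l.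
have C0 : 0 <= C by rewrite addr_ge0 ?enorm_ge0// divr_ge0// ltW.
have Cb i : enorm (egrad psi (y_ i)) <= Num.sqrt n%:R * C.
  apply: enorm_le_entries => // j.
  (* Testing [bnd] on both multiples of [evec j] of size d/2 < d bounds the j-th coordinate from
     both sides. *)
  have hs s : `|s| = d / 2 -> s * (egrad psi (y_ i) j 0 - v j 0) <= K.
    move=> sd; have := bnd i (s *: evec j).
    rewrite dotZr dot_evec !mxE; apply.
    rewrite normrZ sd; apply: (@le_lt_trans _ _ (d / 2)); last by lra.
    apply: ler_piMr; first exact: ltW.
    apply: norm_le_entries => // k l.
    by rewrite !mxE; case: (_ && _); rewrite ?normr1 ?normr0.
  have hn : `|egrad psi (y_ i) j 0 - v j 0| <= K / (d / 2).
    rewrite ler_pdivlMr// -[X in _ * X <= _](gtr0_norm d20) -normrM ler_norml.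
    have := hs _ (gtr0_norm d20); have := hs (- (d / 2)).
    rewrite normrN gtr0_norm// => /(_ erefl); rewrite mulNr => h1 h2.
    by apply/andP; split; lra.
  rewrite -[X in `|X|](subrK (v j 0)) (le_trans (ler_normD _ _))// addrC /C.
  by rewrite lerD// entry_le_enorm.
move=> /cvgryPgt/(_ (Num.sqrt n%:R * C)) [N _ /(_ N (leqnn N))] /=.
by rewrite ltNge Cb.
Unshelve. all: by end_near. Qed.

(** This is the subgradient inequality at [y], tested at its two neighbours on the i-th coordinate
    line. *)
Lemma partial_bounds y i (s : R) : 0 < s -> Y y -> D (y + s *: evec i) ->
  D (y - s *: evec i) ->
  (P y - P (y - s *: evec i)) / s <= 'D_(evec i) P y <= (P (y + s *: evec i) - P y) / s.
Proof.
move=> s0 Yy D1 D2.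
have := egrad_subgradient Yy D1; have := egrad_subgradient Yy D2.
rewrite addrC addKr [y + _ - y]addrC addKr dotNr dotZr dot_evec.
rewrite {1 2}/egrad mxE => h1 h2.
by rewrite ler_pdivrMr// ler_pdivlMr//; apply/andP; split; lra.
Qed.

(* The difference quotients of partial_bounds are continuous in y for fixed s. *)
Lemma partial_continuous y i : Y y -> {for y, continuous (fun x => 'D_(evec i) P x)}.
Proof.
move=> Yy; rewrite /prop_for /continuous_at.
apply/(@cvgrPdist_le R R^o _ (nbhs y)) => e e0.
have e20 : 0 < e / 2 by rewrite divr_gt0.
have [_ dy] := psi_diff Yy.
have contP z : Y z -> {for z, continuous P}.
  by move=> /psi_diff[_ /differentiable_continuous].
have Yz z : Y z -> \forall x \near z, Y x.
  by move=> ?; apply: open_nbhs_nbhs; split => //; exact: domain_open.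
have Yline : \forall s \near (0 : R), Y (y + s *: evec i).
  have : y + s *: evec i @[s --> (0 : R)] --> y + 0 *: evec i.
    by apply: cvgD; [exact: cvg_cst|apply: cvgZr_tmp; exact: cvg_id].
  by rewrite scale0r addr0 => /(_ _ (Yz _ Yy)).
(* One radius serves both signs: the instance at [- s] is the backward quotient at [y]. *)
have [d /= d0 dP] : exists2 d, 0 < d & forall s, s != 0 -> `|s| < d ->
    Y (y + s *: evec i) /\
    `|'D_(evec i) P y - (P (y + s *: evec i) - P y) / s| < e / 2.
  have : \forall s \near (0 : R), s != 0 -> Y (y + s *: evec i) /\
      `|'D_(evec i) P y - (P (y + s *: evec i) - P y) / s| < e / 2.
    have /cvgrPdist_lt/(_ _ e20) := @diff_derivable _ _ _ _ _ (evec i) dy.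
    rewrite near_withinE => quot.
    near=> s => s_neq0; split; first by near: s.
    rewrite [_ / s]mulrC [y + _]addrC.
    by move: s_neq0; near: s.
  move=> /nbhs_normP[d d0 dP]; exists d => // s s_neq0 sd.
  by apply: dP; rewrite //= sub0r normrN.
pose s := d / 2.
have s0 : 0 < s by rewrite divr_gt0.
have sd : `|s| < d by rewrite gtr0_norm// /s; lra.
have [Y1 q1] := dP s (lt0r_neq0 s0) sd.
have := dP (- s); rewrite oppr_eq0 normrN => /(_ (lt0r_neq0 s0) sd).
rewrite scaleNr invrN mulrN -mulNr opprB => -[Y2 q2].
have cline (c : R) : Y (y + c *: evec i) ->
    {for y, continuous (P \o (fun x => x + c *: evec i))}.
  move=> Yc; apply: (@continuous_comp _ _ _ (fun x : 'cV[R]_n => x + c *: evec i) P).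
    exact: cvg_addr_cst.
  exact: contP.
have e2s : 0 < e / 4 * s by rewrite !mulr_gt0.
have D1 : \forall x \near y, Y (x + s *: evec i).
  have : x + s *: evec i @[x --> y] --> y + s *: evec i.
    exact: cvg_addr_cst.
  by move=> /(_ _ (Yz _ Y1)).
have D2 : \forall x \near y, Y (x - s *: evec i).
  have : x - s *: evec i @[x --> y] --> y - s *: evec i.
    exact: cvg_addr_cst.
  by move=> /(_ _ (Yz _ Y2)).
near=> x.
have Yx : Y x by near: x; exact: Yz.
have Dx1 : Y (x + s *: evec i) by near: x.
have Dx2 : Y (x - s *: evec i) by near: x.
have c0 : `|P y - P x| < e / 4 * s.
  by near: x; have /cvgrPdist_lt/(_ _ e2s) := contP _ Yy.
have c1 : `|P (y + s *: evec i) - P (x + s *: evec i)| < e / 4 * s.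
  by near: x; have /cvgrPdist_lt/(_ _ e2s) := cline _ Y1.
have c2 : `|P (y - s *: evec i) - P (x - s *: evec i)| < e / 4 * s.
  near: x; have := cline (- s); rewrite scaleNr => /(_ Y2) /cvgrPdist_lt/(_ _ e2s).
  by [].
apply: difference_quotient_squeeze c1 c2 c0 _ => //.
exact: partial_bounds (domain_sub Dx1) (domain_sub Dx2).
Unshelve. all: by end_near. Qed.

End interior_differentiability.

(** * Functions of class C^m *)
Section Cclass_theory.
Context {R : realType}.

Lemma Cclass_continuous n m (X : set 'cV[R]_n) f x :
  Cclass m X f -> X x -> {for x, continuous f}.
Proof. by case: m => [|m] [fc _]; exact: fc. Qed.

Lemma CclassW n m (X : set 'cV[R]_n) f : Cclass m.+1 X f -> Cclass m X f.
Proof.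
elim: m f => [|m IH] f [fc fd]; split => // i.
have [fdi Cfi] := fd i; split => //; exact: IH.
Qed.

Lemma Cclass_le n m m' (X : set 'cV[R]_n) f :
  (m' <= m)%N -> Cclass m X f -> Cclass m' X f.
Proof.
move=> /subnK <-; elim: (m - m')%N => [//|k IH] Cf.
by apply: IH; exact: CclassW.
Qed.

(** [Cclass] differentiates functions on the whole space; openness of [X] makes their values on [X]
    determine the derivatives at points of [X]. *)
Lemma Cclass_eq n m (X : set 'cV[R]_n) f g : open X ->
  (forall x, X x -> f x = g x) -> Cclass m X f -> Cclass m X g.
Proof.
move=> oX.
have cX (h k : 'cV[R]_n -> R) x : (forall y, X y -> h y = k y) -> X x ->
    {for x, continuous h} -> {for x, continuous k}.
  move=> hk Xx hc; rewrite /prop_for /continuous_at -(hk _ Xx).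
  have nhk : {near x, h =1 k}.
    by near=> y; apply: hk; near: y; exact: open_nbhs_nbhs.
  exact: cvg_trans (near_eq_cvg nhk) hc.
elim: m f g => [|m IH] f g fg [fc fd]; split.
- by move=> x Xx; apply: cX (fc _ Xx).
- by [].
- by move=> x Xx; apply: cX (fc _ Xx).
- move=> i; have [fdi Cfi] := fd i; split.
    move=> x Xx; apply: near_eq_derivable (fdi _ Xx); near=> y.
    by apply: fg; near: y; exact: open_nbhs_nbhs.
  apply: IH Cfi => x Xx; apply: near_eq_derive; near=> y.
  by apply: fg; near: y; exact: open_nbhs_nbhs.
Unshelve. all: by end_near. Qed.

Lemma Cclass_cst n m (X : set 'cV[R]_n) (c : R) : Cclass m X (fun=> c).
Proof.
elim: m c => [|m IH] c; split => //.
- by move=> x _; exact: cst_continuous.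
- by move=> x _; exact: cst_continuous.
move=> i; split => [x _|]; first exact: derivable_cst.
suff -> : (fun x : 'cV[R]_n => 'D_(evec i) (fun=> c) x) = fun=> 0 by [].
by apply/funext => x; exact: derive_cst.
Qed.

Lemma CclassD n m (X : set 'cV[R]_n) f g : open X ->
  Cclass m X f -> Cclass m X g -> Cclass m X (fun x => f x + g x).
Proof.
move=> oX; elim: m f g => [|m IH] f g [fc fd] [gc gd]; split => //.
- by move=> x Xx; apply: continuousD; [exact: fc|exact: gc].
- by move=> x Xx; apply: continuousD; [exact: fc|exact: gc].
move=> i; have [fdi Cfi] := fd i; have [gdi Cgi] := gd i; split.
  by move=> x Xx; apply: derivableD; [exact: fdi|exact: gdi].
apply: (Cclass_eq oX) (IH _ _ Cfi Cgi) => x Xx /=.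
by rewrite -deriveD//; [exact: fdi|exact: gdi].
Qed.

Lemma CclassM n m (X : set 'cV[R]_n) f g : open X ->
  Cclass m X f -> Cclass m X g -> Cclass m X (fun x => f x * g x).
Proof.
move=> oX; elim: m f g => [|m IH] f g Cf Cg; have [fc fd] := Cf; have [gc gd] := Cg;
  split => //.
- by move=> x Xx; apply: continuousM; [exact: fc|exact: gc].
- by move=> x Xx; apply: continuousM; [exact: fc|exact: gc].
move=> i; have [fdi Cfi] := fd i; have [gdi Cgi] := gd i; split.
  by move=> x Xx; apply: derivableM; [exact: fdi|exact: gdi].
apply: (Cclass_eq oX) (CclassD oX (IH _ _ (CclassW Cf) Cgi) (IH _ _ (CclassW Cg) Cfi)).
move=> x Xx /=; rewrite [RHS](@deriveM _ _ f g)//; [exact: fdi|exact: gdi].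
Qed.

(** The derivative of 1/f is -(1/f)^2 times that of f, and the factor 1/f is one order less smooth
    by induction. *)
Lemma CclassV n m (X : set 'cV[R]_n) f : open X ->
  (forall x, X x -> f x != 0) -> Cclass m X f -> Cclass m X (fun x => (f x)^-1).
Proof.
move=> oX f0; elim: m => [|m IH] Cf; have [fc fd] := Cf; split => //.
- by move=> x Xx; apply: continuousV; [exact: f0|exact: fc].
- by move=> x Xx; apply: continuousV; [exact: f0|exact: fc].
move=> i; have [fdi Cfi] := fd i; split.
  by move=> x Xx; apply: derivableV; [exact: f0|exact: fdi].
have Cfv := IH (CclassW Cf).
have := CclassM oX (CclassM oX (CclassM oX Cfv Cfv) Cfi) (Cclass_cst m X (-1)).
apply: (Cclass_eq oX) => x Xx /=.
rewrite [RHS](@deriveV _ _ f)//; [|exact: f0|exact: fdi].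
by rewrite -[_ *: _]/(_ * _) mulrN1 expr2 invfM mulNr.
Qed.

Lemma Cclass_sum n m (X : set 'cV[R]_n) (I : Type) (r : seq I) (Q : pred I)
    (F : I -> 'cV[R]_n -> R) : open X -> (forall i, Q i -> Cclass m X (F i)) ->
  Cclass m X (fun x => \sum_(i <- r | Q i) F i x).
Proof.
move=> oX CF; elim: r => [|i r IH].
  apply: (Cclass_eq oX) (Cclass_cst m X 0) => x _; by rewrite big_nil.
have [Qi|nQi] := boolP (Q i).
  apply: (Cclass_eq oX) (CclassD oX (CF _ Qi) IH) => x _.
  by rewrite big_cons Qi.
by apply: (Cclass_eq oX) IH => x _; rewrite big_cons (negPf nQi).
Qed.

Lemma Cclass_prod n m (X : set 'cV[R]_n) (I : Type) (r : seq I) (Q : pred I)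
    (F : I -> 'cV[R]_n -> R) : open X -> (forall i, Q i -> Cclass m X (F i)) ->
  Cclass m X (fun x => \prod_(i <- r | Q i) F i x).
Proof.
move=> oX CF; elim: r => [|i r IH].
  apply: (Cclass_eq oX) (Cclass_cst m X 1) => x _; by rewrite big_nil.
have [Qi|nQi] := boolP (Q i).
  apply: (Cclass_eq oX) (CclassM oX (CF _ Qi) IH) => x _.
  by rewrite big_cons Qi.
by apply: (Cclass_eq oX) IH => x _; rewrite big_cons (negPf nQi).
Qed.

Lemma Cclass_det n m (X : set 'cV[R]_n) k (A : 'cV[R]_n -> 'M[R]_k) : open X ->
  (forall i j, Cclass m X (fun x => A x i j)) -> Cclass m X (fun x => \det (A x)).
Proof.
move=> oX CA; apply: Cclass_sum => // s _; apply: CclassM => //.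
  exact: Cclass_cst.
by apply: Cclass_prod.
Qed.

(** By Cramer's rule each entry is a cofactor divided by the determinant. *)
Lemma Cclass_invmx n m (X : set 'cV[R]_n) k (A : 'cV[R]_n -> 'M[R]_k) i j : open X ->
  (forall x, X x -> A x \in unitmx) ->
  (forall i j, Cclass m X (fun x => A x i j)) -> Cclass m X (fun x => invmx (A x) i j).
Proof.
move=> oX uA CA.
have Cd : Cclass m X (fun x => (\det (A x))^-1).
  apply: CclassV => //; last exact: Cclass_det.
  by move=> x /uA; rewrite unitmxE unitfE.
have Ca : Cclass m X (fun x => cofactor (A x) j i).
  apply: CclassM => //; first exact: Cclass_cst.
  apply: Cclass_det => // a b.
  by apply: (Cclass_eq oX) (CA (lift j a) (lift i b)) => x _; rewrite !mxE.
apply: (Cclass_eq oX) (CclassM oX Cd Ca) => x /uA ux.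
by rewrite /invmx ux !mxE.
Qed.

Lemma derive_entry n (x v : 'cV[R]_n) i : 'D_v (fun y : 'cV[R]_n => y i 0) x = v i 0.
Proof.
have := @derive_mx R 'cV[R]_n _ _ id x v (@derivable_id _ _ _ _).
by rewrite derive_id => /matrixP/(_ i 0) ->; rewrite mxE.
Qed.

Lemma Cclass_entry n m (X : set 'cV[R]_n) i : open X -> Cclass m X (fun x => x i 0).
Proof.
move=> oX; case: m => [|m]; split => //; try by move=> x _; exact: coord_continuous.
move=> j; split => [x _|].
  by apply: diff_derivable; exact: differentiable_coord.
apply: (Cclass_eq oX) (Cclass_cst m X ((evec j : 'cV[R]_n) i 0)) => x _.
by rewrite derive_entry.
Qed.

Lemma Cclass_differentiable n m (X : set 'cV[R]_n) f x : open X ->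
  Cclass m.+1 X f -> X x -> differentiable f x.
Proof.
move=> oX [fc fd] Xx; apply: differentiable_C1.
  have : nbhs x X by exact: open_nbhs_nbhs.
  by apply: filterS => y Xy i; have [h _] := fd i; exact: h.
by move=> i; have [_ Ci] := fd i; exact: Cclass_continuous Ci Xx.
Qed.

(** Induction on [m]: the chain rule writes a partial of [q \o G] as a sum of products of a partial
    of [q] composed with [G], covered by the induction hypothesis, and a partial of [G]. *)
Lemma Cclass_comp n k m (X : set 'cV[R]_n) (Y : set 'cV[R]_k) G q :
  open X -> open Y -> (forall x, X x -> Y (G x)) ->
  vCclass m X G -> Cclass m Y q -> Cclass m X (q \o G).
Proof.
move=> oX oY XY; elim: m q => [|m IH] q CG Cq.
  split => // x Xx; apply: continuous_comp; last exact: Cclass_continuous Cq (XY _ Xx).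
  by apply: continuous_mx => i j; rewrite ord1; exact: Cclass_continuous (CG i) Xx.
have dq x : X x -> differentiable q (G x).
  by move=> Xx; apply: Cclass_differentiable Cq (XY _ Xx).
have CGW : vCclass m X G by move=> i; exact: CclassW.
have [qc qd] := Cq.
have dG l x i : X x -> derivable (fun x => G x l 0) x (evec i).
  by move=> Xx; have [_ /(_ i)[h _]] := CG l; exact: h.
split.
  move=> x Xx; apply: continuous_comp; last exact: Cclass_continuous Cq (XY _ Xx).
  by apply: continuous_mx => i j; rewrite ord1; exact: Cclass_continuous (CG i) Xx.
move=> i.
have E x : X x -> is_derive x (evec i) (q \o G)
    (\sum_l 'D_(evec l) q (G x) * 'D_(evec i) (fun y => G y l 0) x).
  by move=> Xx; apply: is_derive_gradient_comp => [l|]; [exact: dG|exact: dq].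
split => [x /E[]//|].
have := @Cclass_sum n m X 'I_k (index_enum 'I_k) xpredT
  (fun l x => 'D_(evec l) q (G x) * 'D_(evec i) (fun y => G y l 0) x) oX.
have C l : true ->
    Cclass m X (fun x => 'D_(evec l) q (G x) * 'D_(evec i) (fun y => G y l 0) x).
  move=> _; apply: CclassM => //.
    by apply: (IH (fun y => 'D_(evec l) q y)) => //; have [] := qd l.
  by have [_ /(_ i)[]] := CG l.
move=> /(_ C); apply: (Cclass_eq oX) => x /E[_ <-//].
Qed.

Lemma vCclass_inverse n m (Y : set 'cV[R]_n) (p G : 'cV[R]_n -> 'cV[R]_n) :
  open Y -> (forall v, Y (G v)) -> (forall v, p (G v) = v) ->
  (forall y, Y y -> G (p y) = y) -> (forall v, differentiable G v) ->
  vCclass m Y p -> vCclass m setT G.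
Proof.
move=> oY YG pG Gp dG; case: m => [|m] Cp.
  by move=> i; split => // x _; apply: continuous_entry; exact: differentiable_continuous.
(* Only G has to be Frechet differentiable here: p enters through its partial
   derivatives along coordinate lines. *)
have J v : Jacobian G v *m Jacobian p (G v) = 1%:M.
  apply/matrixP => l i.
  have dp a : derivable (fun y => p y a 0) (G v) (evec i).
    by have [_ /(_ i)[h _]] := Cp a; exact: h.
  have dGl : differentiable (fun u => G u l 0) (p (G v)).
    by apply: differentiable_entry.
  have [_] := is_derive_gradient_comp dp dGl.
  rewrite pG !mxE => E.
  transitivity ('D_(evec i) ((fun u => G u l 0) \o p) (G v)).
    by rewrite E; apply: eq_bigr => a _; rewrite !mxE.
  (* [G \o p] is known to be the identity on [Y], a neighbourhood of [G v], and this determines the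
     derivative there. *)
  transitivity ('D_(evec i) (fun u : 'cV[R]_n => u l 0) (G v)).
    apply: near_eq_derive; have : nbhs (G v) Y by exact: open_nbhs_nbhs.
    by apply: filterS => y Yy /=; rewrite Gp.
  by rewrite derive_entry !mxE eqxx andbT.
have uJ v : Jacobian p (G v) \in unitmx by have [] := mulmx1_unit (J v).
have JE v : Jacobian G v = invmx (Jacobian p (G v)).
  by rewrite -[LHS](mulmxK (uJ v)) J mul1mx.
(* Bootstrap along [JE]: if [G] is C^j with j <= m, then [Jacobian p] composed with [G] is C^j,
   hence so is its inverse, so the partials of [G] are C^j. *)
suff : forall j, (j <= m.+1)%N -> vCclass j setT G by exact.
elim => [_|j IH jm].
  by move=> i; split => // x _; apply: continuous_entry; exact: differentiable_continuous.
have CG := IH (ltnW jm).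
move=> l; split => [x _|i].
  by apply: continuous_entry; exact: differentiable_continuous.
split => [x _|]; first by apply: diff_derivable; exact: differentiable_entry.
have : Cclass j setT (fun v => invmx (Jacobian p (G v)) l i).
  apply: Cclass_invmx => // [|a b]; first exact: openT.
  have [_ /(_ b)[_ Cab]] := Cp a.
  have := Cclass_comp openT oY (fun v _ => YG v) CG (@Cclass_le _ m j _ _ jm Cab).
  by apply: (Cclass_eq openT) => x _; rewrite /= mxE.
by apply: (Cclass_eq openT) => x _; rewrite -JE mxE.
Qed.

End Cclass_theory.

(** * Affine maps and relative interiors *)
Section affine_maps.
Context {R : realType}.

Lemma is_derive_affine m n p (c : 'M[R]_(m, p)) (M : 'M[R]_(m, n)) (x v : 'M[R]_(n, p)) :
  is_derive x v (fun y => c + M *m y) (M *m v).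
Proof.
have E : \forall h \near (0 : R)^',
    h^-1 *: (((fun y => c + M *m y) \o shift x) (h *: v) - (c + M *m x)) = M *m v.
  near=> h; have h0 : h != 0 by near: h; exact: nbhs_dnbhs_neq.
  rewrite /= mulmxDr -scalemxAr opprD addrACA subrr add0r addrK scalerA.
  by rewrite mulVf// scale1r.
split; first exact: (is_cvg_near_cst _ E).
exact: lim_near_cst E.
Unshelve. all: by end_near. Qed.

Lemma differentiable_affine m n (c : 'cV[R]_m) (M : 'M[R]_(m, n)) x :
  differentiable (fun y : 'cV[R]_n => c + M *m y) x.
Proof.
apply: differentiableD; first exact: differentiable_cst.
by apply: differentiable_mulmx; exact: ex_diff.
Qed.

Lemma JacobianE m n (f : 'cV[R]_m -> 'cV[R]_n) x i j :
  derivable f x (evec j) -> Jacobian f x i j = 'D_(evec j) f x i 0.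
Proof. by move=> fd; rewrite derive_mx// !mxE. Qed.

Lemma Jacobian_affine m n (c : 'cV[R]_m) (M : 'M[R]_(m, n)) x :
  Jacobian (fun y : 'cV[R]_n => c + M *m y) x = M.
Proof.
apply/matrixP => i j; have [h1 h2] := is_derive_affine c M x (evec j).
by rewrite JacobianE// h2 -colE mxE.
Qed.

Lemma Jacobian_comp m n k (f : 'cV[R]_n -> 'cV[R]_k) (g : 'cV[R]_m -> 'cV[R]_n) x :
  differentiable g x -> differentiable f (g x) ->
  Jacobian (f \o g) x = Jacobian f (g x) *m Jacobian g x.
Proof.
move=> dg df; apply/matrixP => i j.
have dgl l : derivable (fun y => g y l 0) x (evec j).
  by apply: diff_derivable; exact: differentiable_entry.
have [_] := is_derive_gradient_comp dgl (differentiable_entry i 0 df).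
rewrite !mxE => E; rewrite [LHS]E.
by apply: eq_bigr => l _; rewrite !mxE.
Qed.

Lemma vCclass_affine k m n q (X : set 'cV[R]_k) (c : 'cV[R]_m) (M : 'M[R]_(m, n)) f :
  open X -> vCclass q X f -> vCclass q X (fun y => c + M *m f y).
Proof.
move=> oX Cf i.
have := CclassD oX (Cclass_cst q X (c i 0)) (Cclass_sum (index_enum 'I_n) oX
  (fun j (_ : true) => CclassM oX (Cclass_cst q X (M i j)) (Cf j))).
by apply: (Cclass_eq oX) => x _; rewrite !mxE.
Qed.

End affine_maps.

(** * Relative interiors, affine hulls, and the parametrization of the affine hull *)

Section relative_interior.
Context {R : realType}.

Lemma affine_hull_comb n (C : set 'cV[R]_n) (v w : 'cV[R]_n) (a : R) :
  C v -> C w -> affine_hull C (w + a *: (v - w)).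
Proof.
move=> Cv Cw; exists 2%N, (fun i => if i == 0 then a else 1 - a),
  (fun i => if i == 0 then v else w); split.
- by move=> i; case: ifP.
- by rewrite !big_ord_recl big_ord0 /= addr0 addrCA subrr addr0.
rewrite !big_ord_recl big_ord0 /= addr0 scalerBl scale1r scalerBr.
by rewrite addrCA.
Qed.

Lemma affine_hull_sub n p (C : set 'cV[R]_n) (A : 'M[R]_(p, n)) b :
  C `<=` [set w | A *m w = b] -> affine_hull C `<=` [set w | A *m w = b].
Proof.
move=> CA _ [m [c [v [Cv c1 ->]]]] /=.
rewrite mulmx_sumr (eq_bigr (fun i => c i *: b)); last first.
  by move=> i _; rewrite -scalemxAr CA.
by rewrite -scaler_suml c1 scale1r.
Qed.

Lemma relint_sub n (C : set 'cV[R]_n) : relint C `<=` C.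
Proof. by move=> x [Cx /nbhs_singleton]; exact. Qed.

Lemma relint_near n (C : set 'cV[R]_n) x :
  relint C x -> \forall y \near x, affine_hull C y -> relint C y.
Proof.
by move=> [_ /nbhs_interior]; apply: filterS => y Cy hy; split.
Qed.

Lemma near_line n (x v : 'cV[R]_n) (P : set 'cV[R]_n) : nbhs x P ->
  exists2 t : R, 0 < t & P (x + t *: v).
Proof.
move=> xP.
have cv : x + t *: v @[t --> (0 : R)] --> x.
  rewrite -[X in _ --> X]addr0 -[X in _ + X](scale0r v).
  by apply: cvgD; [exact: cvg_cst|apply: cvgZr_tmp; exact: cvg_id].
have /nbhs_normP[d /= d0 dP] := cv _ xP.
exists (d / 2); first by rewrite divr_gt0.
by apply: dP; rewrite /= sub0r normrN gtr0_norm ?divr_gt0//; lra.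
Qed.

Section same_relint.
Variables (n p : nat) (S D : set 'cV[R]_n) (A : 'M[R]_(p, n)) (b : 'cV[R]_p).
Variable wbar : 'cV[R]_n.
Hypotheses (S_aff : affine_hull S = [set w | A *m w = b]).
Hypotheses (SD : relint S = relint D) (wbar_S : relint S wbar).

Lemma relint_affine w : relint S w -> A *m w = b.
Proof. by move=> [+ _]; rewrite S_aff. Qed.

(** A short move from [wbar] towards [x] stays in [relint D], which equals [relint S]. So the
    equations hold at two distinct points of the line through [wbar] and [x], hence at [x]. *)
Lemma sub_affine_of_relint : D `<=` [set w | A *m w = b].
Proof.
move=> x Dx /=; have Dw : relint D wbar by rewrite -SD.
have [t t0] := near_line (x - wbar) (relint_near Dw).
have h := affine_hull_comb t Dx (relint_sub Dw).
move=> /(_ h); rewrite -SD => /relint_affine.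
rewrite mulmxDr -scalemxAr mulmxBr (relint_affine wbar_S) => /eqP.
rewrite -subr_eq0 addrC addKr scaler_eq0 gt_eqF//= subr_eq0.
by move/eqP.
Qed.

(** For w satisfying the equations, a short move from [wbar] towards w ends in [relint S], hence in
    [D]; extrapolating by [t^-1] recovers w as an affine combination of points of [D]. *)
Lemma affine_hull_relint : affine_hull D = [set w | A *m w = b].
Proof.
apply/seteqP; split; first exact: affine_hull_sub sub_affine_of_relint.
move=> w /= Aw; have Dw : relint D wbar by rewrite -SD.
have [t t0] := near_line (w - wbar) (relint_near wbar_S).
rewrite S_aff /= mulmxDr -scalemxAr mulmxBr Aw (relint_affine wbar_S) subrr.
rewrite scaler0 addr0 SD => /(_ erefl)/relint_sub h.
have := affine_hull_comb t^-1 h (relint_sub Dw).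
by rewrite [_ + _ - _]addrC addKr scalerA mulVf ?gt_eqF// scale1r addrC subrK.
Qed.

End same_relint.

Section parametrization.
Variables (n r p : nat) (A : 'M[R]_(p, n)) (b : 'cV[R]_p) (N : 'M[R]_(n, r)).
Variable wbar : 'cV[R]_n.
Hypotheses (N_basis : orthonormal_basis_ker A N) (Aw : A *m wbar = b).

Lemma param_affine y : A *m (wbar + N *m y) = b.
Proof.
have [_ kerN] := N_basis; rewrite mulmxDr Aw (_ : A *m (N *m y) = 0) ?addr0//.
by apply/kerN; exists y.
Qed.

Lemma paramK y : N^T *m (wbar + N *m y - wbar) = y.
Proof.
by have [NN _] := N_basis; rewrite [wbar + _]addrC addrK mulmxA NN mul1mx.
Qed.

Lemma param_surj w : A *m w = b -> wbar + N *m (N^T *m (w - wbar)) = w.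
Proof.
move=> Aw'; have [_ kerN] := N_basis.
have /kerN[y wy] : A *m (w - wbar) = 0 by rewrite mulmxBr Aw' Aw subrr.
have -> : w = wbar + N *m y by rewrite -wy addrC subrK.
by rewrite paramK.
Qed.

(** The maps y -> wbar + N y and w -> N^T (w - wbar) are continuous and mutually inverse between R^r
    and the affine hull, so relative neighbourhoods correspond to neighbourhoods. *)
Lemma relint_param (C : set 'cV[R]_n) : affine_hull C = [set w | A *m w = b] ->
  [set y | relint C (wbar + N *m y)] = interior [set y | C (wbar + N *m y)].
Proof.
move=> CA; apply/seteqP; split => y /=.
  move=> [_ h].
  have : nbhs y (fun z => affine_hull C (wbar + N *m z) -> C (wbar + N *m z)).
    exact: (differentiable_continuous (differentiable_affine wbar N y) h).
  by apply: filterS => z; apply; rewrite CA /= param_affine.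
move=> h; split; first by rewrite CA /= param_affine.
have c : {for wbar + N *m y, continuous (fun w : 'cV[R]_n => N^T *m (w - wbar))}.
  apply: continuous_mulmx; exact: cvg_addr_cst.
have : nbhs (wbar + N *m y) (fun w => C (wbar + N *m (N^T *m (w - wbar)))).
  by apply: (c (fun y => C (wbar + N *m y))); rewrite paramK.
by apply: filterS => w; rewrite CA /= => h1 /param_surj h2; move: h1; rewrite /= h2.
Qed.

End parametrization.
End relative_interior.

(** * The solution map *)
Section legendre_solution.
Context {R : realType} (n p r : nat).
Variables (S : set 'cV[R]_n) (A : 'M[R]_(p, n)) (b : 'cV[R]_p).
Variables (N : 'M[R]_(n, r)) (wbar : 'cV[R]_n) (phi : 'cV[R]_n -> \bar R) (mu : R).
Hypotheses (S_aff : affine_hull S = [set w | A *m w = b]).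
Hypotheses (N_basis : orthonormal_basis_ker A N) (wbar_S : relint S wbar).
Hypotheses (phi_adm : admissible_legendre S wbar N phi) (mu0 : 0 < mu).
Let psi := reduced phi wbar N.
Let Y := param_domain S wbar N.
Hypothesis psi_sc : strongly_convex mu psi.
Local Notation P := (fine \o psi).
Local Notation G := (egrad (conjugate psi)).

Let Abar : A *m wbar = b. Proof. exact: (relint_affine S_aff wbar_S). Qed.

Lemma reduced_Ny y : psi y != -oo%E.
Proof. by have [[h _] _ _ _ _] := phi_adm; exact: h. Qed.

Lemma edom_affine w : edom phi w -> A *m w = b.
Proof.
have [_ _ _ SD _] := phi_adm.
exact: (sub_affine_of_relint S_aff SD wbar_S).
Qed.

Lemma param_domainE : Y = interior (edom psi).
Proof.
have [_ _ _ SD _] := phi_adm.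
have := relint_param N_basis Abar (affine_hull_relint S_aff SD wbar_S).
by rewrite -SD.
Qed.

Lemma param_domain_neq0 : Y !=set0.
Proof. by exists 0; rewrite /Y /param_domain /= mulmx0 addr0. Qed.

Lemma reduced_lsc : lower_semicontinuous psi.
Proof.
have [_ lsc _ _ _] := phi_adm => y a /lsc[V Vy aV].
exists (fun y => V (wbar + N *m y)); last by move=> z /aV.
exact: (differentiable_continuous (differentiable_affine wbar N y) Vy).
Qed.

Lemma reduced_ediff y : Y y -> ediff psi y.
Proof. by have [_ _ _ _ [_ [h _] _]] := phi_adm; exact: h. Qed.

Lemma conjugate_fin v : conjugate psi v \is a fin_num.
Proof.
have [_ _ _ _ [_ _ h]] := phi_adm.
by have [[/nbhs_singleton]] := h v.
Qed.

Lemma conjugate_differentiable v : differentiable (fine \o conjugate psi) v.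
Proof. by have [_ _ _ _ [_ _ h]] := phi_adm; have [[]] := h v. Qed.

Lemma gradient_conjugate_differentiable v : differentiable G v.
Proof. by have [_ _ _ _ [_ _ h]] := phi_adm; have [] := h v. Qed.

Lemma gradient_conjugate_unique v y : is_argmax psi v y -> y = G v.
Proof.
move=> m; apply/esym; apply: (argmax_gradient_conjugate reduced_Ny) m.
  exact: conjugate_fin.
exact: conjugate_differentiable.
Qed.

Lemma gradient_conjugate_argmax v : is_argmax psi v (G v).
Proof.
have [y m] := argmax_exists mu0 reduced_Ny psi_sc reduced_lsc (conjugate_fin v).
by rewrite -(gradient_conjugate_unique m).
Qed.

Lemma gradient_conjugate_domain v : Y (G v).
Proof.
have [_ _ _ _ [_ [_ blowup] _]] := phi_adm.
apply: (argmax_domain mu0 reduced_Ny psi_sc param_domainE reduced_ediff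
  param_domain_neq0 blowup).
exact: gradient_conjugate_argmax.
Qed.

Lemma gradient_conjugateK v : egrad psi (G v) = v.
Proof.
exact: (argmax_egrad param_domainE reduced_ediff (gradient_conjugate_domain v)
  (gradient_conjugate_argmax v)).
Qed.

Lemma gradientK y : Y y -> G (egrad psi y) = y.
Proof.
move=> Yy; apply/esym/gradient_conjugate_unique.
exact: (egrad_is_argmax mu0 reduced_Ny psi_sc param_domainE reduced_ediff Yy).
Qed.

Lemma gradient_conjugate_lipschitz u v :
  enorm (G u - G v) <= mu^-1 * enorm (u - v).
Proof.
rewrite ler_pdivlMl//.
exact: (argmax_lipschitz mu0 reduced_Ny psi_sc (gradient_conjugate_argmax u)
  (gradient_conjugate_argmax v)).
Qed.

(** Convexity upgrades differentiability on the open set [Y] to a continuous gradient; this yields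
    the continuity of the inverse solution map. *)
Lemma egrad_continuous y : Y y -> {for y, continuous (egrad psi)}.
Proof.
move=> Yy; apply: continuous_mx => i j; rewrite ord1.
have := @partial_continuous _ _ _ _ mu0 reduced_Ny psi_sc _ param_domainE
  reduced_ediff y i Yy.
suff -> : (fun y => egrad psi y i 0) = 'D_(evec i) P by [].
by apply/funext => z; rewrite mxE.
Qed.

Lemma gradient_conjugate_Cclass m : Cclass m.+1 Y P ->
  vCclass m Y (egrad psi) /\ vCclass m setT G.
Proof.
move=> CP.
have Cp : vCclass m Y (egrad psi).
  move=> i; have [_ /(_ i)[_]] := CP.
  suff -> : (fun y => egrad psi y i 0) = 'D_(evec i) P by [].
  by apply/funext => z; rewrite mxE.
split => //; apply: vCclass_inverse Cp.
- exact: domain_open param_domainE.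
- exact: gradient_conjugate_domain.
- exact: gradient_conjugateK.
- exact: gradientK.
- exact: gradient_conjugate_differentiable.
Qed.

(** * The solution map: formula, Jacobian, Lipschitz bound, image, regularity *)

Section solution_map.
Variables (k : nat) (F : 'M[R]_(n, k)).
Let B := N^T *m F.
Let w := wsol F phi.

Let objective z y : dot (F *m z) (wbar + N *m y) =
  dot (F *m z) wbar - dot (- (B *m z)) y.
Proof.
rewrite dotDr dotNl opprK; congr (_ + _).
by rewrite dotC dot_mulmxl mulmxA dotC.
Qed.

Lemma optimalE z : optimal F phi z = [set wbar + N *m G (- (B *m z))].
Proof.
set v := - (B *m z); have [DG Gmax] := gradient_conjugate_argmax v.
apply/seteqP; split => [x opt|_ -> x] /=.
  (* [optimal] does not itself ask for a finite value; comparison with the finite value at [G v]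
     excludes +oo. *)
  have Dx : edom phi x.
    rewrite /edom /= ltey; apply/eqP => xoo.
    have := opt (wbar + N *m G v).
    rewrite xoo addey// leye_eq -[phi _]/(psi (G v)) (edomE reduced_Ny DG).
    by [].
  have xE := param_surj N_basis Abar (edom_affine Dx).
  set y := N^T *m _ in xE.
  suff m : is_argmax psi v y by rewrite -(gradient_conjugate_unique m) xE.
  have Dy : edom psi y by rewrite /edom /= /psi /reduced xE.
  split => // y' Dy'.
  have := opt (wbar + N *m y'); rewrite -xE !objective.
  rewrite -[phi (_ + N *m y)]/(psi y) -[phi (_ + N *m y')]/(psi y').
  rewrite (edomE reduced_Ny Dy) (edomE reduced_Ny Dy') -!EFinD lee_fin -/v /=.
  lra.
have [Dx|nDx] := pselect (edom phi x); last first.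
  have -> : phi x = +oo%E by apply/eqP; rewrite eq_le leey/= leNgt; apply/negP.
  by rewrite addey// leey.
have xE := param_surj N_basis Abar (edom_affine Dx).
set y := N^T *m _ in xE.
have Dy : edom psi y by rewrite /edom /= /psi /reduced xE.
rewrite -xE !objective -[phi (_ + N *m G v)]/(psi (G v)) -[phi (_ + N *m y)]/(psi y).
rewrite (edomE reduced_Ny Dy) (edomE reduced_Ny DG) -!EFinD lee_fin -/v /=.
have := Gmax _ Dy; rewrite /=; lra.
Qed.

Lemma wsolE z : w z = wbar + N *m G (- (B *m z)).
Proof.
have : optimal F phi z (w z).
  by apply: getPex; exists (wbar + N *m G (- (B *m z))); rewrite optimalE.
by rewrite optimalE.
Qed.

Lemma wsol_optimal z : [/\ exists! w0, optimal F phi z w0, optimal F phi z (w z) &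
  relint S (w z)].
Proof.
rewrite wsolE optimalE; split => //.
  by exists (wbar + N *m G (- (B *m z))); split => // _ ->.
exact: gradient_conjugate_domain.
Qed.

(** The form [0 + (- B) *m z] makes both outer maps instances of c + M y, to which the affine lemmas
    apply. *)
Let wE : w = (fun y => wbar + N *m y) \o (G \o (fun z => 0 + (- B) *m z)).
Proof. by apply/funext => z; rewrite wsolE /= add0r mulNmx. Qed.

Lemma wsol_differentiable z : differentiable w z.
Proof.
rewrite wE; apply: differentiable_comp; last exact: differentiable_affine.
apply: differentiable_comp; first exact: differentiable_affine.
exact: gradient_conjugate_differentiable.
Qed.

Lemma Jacobian_wsol z :
  Jacobian w z = - (N *m Hessian (fine \o conjugate psi) (- (B *m z)) *m B).
Proof.
have dB := differentiable_affine 0 (- B) z.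
have dG := gradient_conjugate_differentiable (0 + - B *m z).
have dGB := differentiable_comp dB dG.
have dN := differentiable_affine wbar N (G (0 + - B *m z)).
rewrite wE (Jacobian_comp dGB dN) (Jacobian_comp dB dG) !Jacobian_affine.
have -> : - (B *m z) = 0 + - B *m z by rewrite add0r mulNmx.
by rewrite !mulmxN mulmxA.
Qed.

Lemma wsol_lipschitz z1 z2 :
  enorm (w z1 - w z2) <= opnorm B / mu * enorm (z1 - z2).
Proof.
have [NN _] := N_basis.
rewrite !wsolE opprD addrACA subrr add0r -mulmxBr enorm_orthonormal//.
apply: le_trans (gradient_conjugate_lipschitz _ _) _.
rewrite -opprD -scaleN1r enormZ normrN1 mul1r -mulmxBr.
by rewrite [_ / _]mulrC -mulrA ler_pM2l ?invr_gt0// enorm_le_opnorm.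
Qed.

Lemma wsol_lipschitz_opnorm (z1 z2 : 'cV[R]_k) : opnorm B / mu * enorm (z1 - z2) <=
  opnorm F / mu * enorm (z1 - z2).
Proof.
have [NN _] := N_basis.
rewrite ler_wpM2r ?enorm_ge0// ler_wpM2r ?invr_ge0 ?(ltW mu0)//.
exact: opnorm_trmx_orthonormal.
Qed.

Lemma wsol_inv z y : Y y -> B *m z = - egrad psi y -> w z = wbar + N *m y.
Proof. by move=> Yy Bz; rewrite wsolE Bz opprK gradientK. Qed.

Lemma wsol_image : \rank B = r -> range w = relint S.
Proof.
move=> rB; apply/seteqP; split => [_ [z _ <-]|s Ss].
  by have [] := wsol_optimal z.
have sE := param_surj N_basis Abar (relint_affine S_aff Ss).
set y := N^T *m _ in sE.
have Yy : Y y by rewrite /Y /param_domain /= sE.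
(* Rank r makes [pinvmx B] a right inverse of [B], so this z solves B z = - grad psi(y). *)
exists (- (pinvmx B *m egrad psi y)) => //; rewrite -[RHS]sE; apply: wsol_inv => //.
by rewrite mulmxN mulmxA mulmxVp ?mul1mx// /row_free rB.
Qed.

Lemma wsol_Cclass m : Cclass m.+1 Y P -> vCclass m setT w.
Proof.
move=> /gradient_conjugate_Cclass[_ CG]; rewrite wE.
apply: (vCclass_affine wbar N openT) => i.
apply: (@Cclass_comp _ _ _ _ setT setT (fun z => 0 + - B *m z) (fun v => G v i 0)).
- exact: openT.
- exact: openT.
- by [].
- apply: (vCclass_affine 0 (- B) openT) => j.
  exact: (Cclass_entry m j openT).
- exact: CG.
Qed.

End solution_map.

(** * The case k = r: the inverse of the solution map *)

Section square.
Variable F : 'M[R]_(n, r).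
Let B := N^T *m F.
Let w := wsol F phi.
Hypothesis rB : \rank B = r.
Let uB : B \in unitmx. Proof. by rewrite -row_free_unit /row_free rB. Qed.

(* Written as an affine map of the gradient so that the lemmas on c + M *m y apply. *)
Definition wsol_inverse (s : 'cV[R]_n) : 'cV[R]_r :=
  0 + - invmx B *m egrad psi (N^T *m (s - wbar)).

Lemma wsol_inverse_param y : wsol_inverse (wbar + N *m y) = - (invmx B *m egrad psi y).
Proof. by rewrite /wsol_inverse (paramK _ N_basis) add0r mulNmx. Qed.

Lemma wsolK z : wsol_inverse (w z) = z.
Proof.
rewrite /w wsolE wsol_inverse_param gradient_conjugateK mulmxN opprK.
by rewrite mulmxA mulVmx// mul1mx.
Qed.

Lemma wsol_inverseK s : relint S s -> w (wsol_inverse s) = s.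
Proof.
move=> Ss; have sE := param_surj N_basis Abar (relint_affine S_aff Ss).
set y := N^T *m _ in sE.
have Yy : Y y by rewrite /Y /param_domain /= sE.
rewrite -[RHS]sE; apply: wsol_inv => //.
by rewrite -sE wsol_inverse_param mulmxN mulmxA mulmxV// mul1mx.
Qed.

Lemma wsol_bij : set_bij setT (relint S) w.
Proof.
split.
- by move=> z _; have [] := wsol_optimal F z.
- by move=> z1 z2 _ _ /(congr1 wsol_inverse); rewrite !wsolK.
- by move=> s Ss; exists (wsol_inverse s) => //; exact: wsol_inverseK.
Qed.

Lemma wsol_inverse_continuous : {within relint S, continuous wsol_inverse}.
Proof.
(* Continuity is proved in the ambient space at each point of [relint S]: s -> N^T (s - wbar)
   extends the coordinate map beyond the affine hull. *)
apply: continuous_in_subspaceT => s /set_mem Ss.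
have sE := param_surj N_basis Abar (relint_affine S_aff Ss).
have Yy : Y (N^T *m (s - wbar)) by rewrite /Y /param_domain /= sE.
have c1 : {for s, continuous (fun s : 'cV[R]_n => N^T *m (s - wbar))}.
  by apply: continuous_mulmx; exact: cvg_addr_cst.
have c2 : {for s, continuous (egrad psi \o (fun s : 'cV[R]_n => N^T *m (s - wbar)))}.
  by apply: continuous_comp; [exact: c1|exact: egrad_continuous].
have c3 := differentiable_continuous (differentiable_affine 0 (- invmx B)
  (egrad psi (N^T *m (s - wbar)))).
exact: (continuous_comp c2 c3).
Qed.

Lemma wsol_inverse_Cclass m : Cclass m.+1 Y P ->
  vCclass m Y (fun y => wsol_inverse (wbar + N *m y)).
Proof.
move=> /gradient_conjugate_Cclass[Cp _].
rewrite (_ : (fun y => _) = fun y => 0 + - invmx B *m egrad psi y).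
  by apply: vCclass_affine => //; exact: domain_open param_domainE.
by apply/funext => y; rewrite wsol_inverse_param add0r mulNmx.
Qed.

End square.

End legendre_solution.

Theorem theorem1 (R : realType) (n p r : nat)
  (p_lt_n : (p < n)%N) (r_def : r = (n - p)%N)
  (S : set 'cV[R]_n) (S_neq0 : S !=set0) (S_closed : closed S)
  (S_convex : convex_set (S : set (convex_lmodType 'cV[R]_n)))
  (A : 'M[R]_(p, n)) (b : 'cV[R]_p) (A_full : \rank A = p)
  (S_aff : affine_hull S = [set w | A *m w = b])
  (N : 'M[R]_(n, r)) (N_basis : orthonormal_basis_ker A N)
  (wbar : 'cV[R]_n) (wbar_S : relint S wbar)
  (phi : 'cV[R]_n -> \bar R) (phi_adm : admissible_legendre S wbar N phi)
  (mu : R) (mu_gt0 : 0 < mu)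
  (psi_sc : strongly_convex mu (reduced phi wbar N)) :
  let psi := reduced phi wbar N in
  let Y := param_domain S wbar N in
  (forall (k : nat) (F : 'M[R]_(n, k)),
    (r <= k)%N ->
    let B := N^T *m F in
    \rank B = r ->
    let w := wsol F phi in
    [/\ (* 1 *)
        forall z : 'cV[R]_k,
          [/\ exists! w0 : 'cV[R]_n, optimal F phi z w0,
              optimal F phi z (w z) & relint S (w z)],
        (* 2 *)
        forall z : 'cV[R]_k,
          [/\ w z = wbar + N *m egrad (conjugate psi) (- (B *m z)),
              differentiable w z &
              Jacobian w z =
                - (N *m Hessian (fine \o conjugate psi) (- (B *m z)) *m B)],
        (* 3 *)
        (exists L : R, forall z1 z2 : 'cV[R]_k,
          enorm (w z1 - w z2) <= L * enorm (z1 - z2)) /\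
        (forall z1 z2 : 'cV[R]_k,
          enorm (w z1 - w z2) <= opnorm B / mu * enorm (z1 - z2)
            <= opnorm F / mu * enorm (z1 - z2)) &
        (* 4, image *)
        range w = relint S]) /\
  (* 4, case k = r *)
  (forall F : 'M[R]_(n, r),
    let B := N^T *m F in
    \rank B = r ->
    let w := wsol F phi in
    set_bij [set: 'cV[R]_r] (relint S) w /\
    exists winv : 'cV[R]_n -> 'cV[R]_r,
      [/\ forall z : 'cV[R]_r, winv (w z) = z,
          forall s : 'cV[R]_n, relint S s -> w (winv s) = s,
          {within relint S, continuous winv},
          forall y : 'cV[R]_r, Y y ->
            winv (wbar + N *m y) = - (invmx B *m egrad psi y) &
          forall m : nat, (2 <= m)%N -> Cclass m Y (fine \o psi) ->
            vCclass m.-1 [set: 'cV[R]_r] w /\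
            vCclass m.-1 Y (fun y => winv (wbar + N *m y))]).
Proof.
move=> psi Y; split.
  move=> k F _ B rB w; split.
  - by move=> z; exact: (wsol_optimal S_aff N_basis wbar_S phi_adm mu_gt0 psi_sc).
  - move=> z; split.
    + exact: (wsolE S_aff N_basis wbar_S phi_adm mu_gt0 psi_sc).
    + exact: (wsol_differentiable S_aff N_basis wbar_S phi_adm mu_gt0 psi_sc).
    + exact: (Jacobian_wsol S_aff N_basis wbar_S phi_adm mu_gt0 psi_sc).
  - have lip := wsol_lipschitz S_aff N_basis wbar_S phi_adm mu_gt0 psi_sc F.
    split; first by exists (opnorm B / mu) => z1 z2; exact: lip.
    by move=> z1 z2; rewrite lip (wsol_lipschitz_opnorm N_basis mu_gt0).
  - exact: (wsol_image S_aff N_basis wbar_S phi_adm mu_gt0 psi_sc).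
move=> F B rB w; split.
  exact: (wsol_bij S_aff N_basis wbar_S phi_adm mu_gt0 psi_sc).
exists (wsol_inverse N wbar phi F); split.
- exact: (wsolK S_aff N_basis wbar_S phi_adm mu_gt0 psi_sc).
- exact: (wsol_inverseK S_aff N_basis wbar_S phi_adm mu_gt0 psi_sc).
- exact: (wsol_inverse_continuous S_aff N_basis wbar_S phi_adm mu_gt0 psi_sc).
- by move=> y _; apply: wsol_inverse_param; exact: N_basis.
- case=> [//|m] _ Cm; split.
    exact: (wsol_Cclass S_aff N_basis wbar_S phi_adm mu_gt0 psi_sc).
  exact: (wsol_inverse_Cclass S_aff N_basis wbar_S phi_adm mu_gt0 psi_sc).
Qed.
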